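(* Fix $\vartheta\in(0,1)$ and $r>0$, and consider a sequence, indexed by $p$, of Asymptotic Rare and Weak models $ARW(\vartheta,r,\Omega)$ with $\Omega=\Omega_{p,p}$. Let $H_0^{(p)}$ and $H_1^{(p)}$ be the associated hypotheses about the observation $Y\in\mathbb{R}^p$, and let $\rho^*$ be the standard phase function for detection. If $r<\rho^*(\vartheta)$, then for any sequence of tests of $H_1^{(p)}$ against $H_0^{(p)}$, the sum of the Type I and Type II errors tends to $1$ as $p\to\infty$. If $r>\rho^*(\vartheta)$, then there is a (sequence of) test(s) for which the sum of the Type I and Type II errors tends to $0$ as $p\to\infty$.
   Context: The model $ARW(\vartheta,r,\Omega)$, with $\vartheta\in(0,1)$ and $r>0$ fixed, is the following. For each $p$, one observes $Y=\beta+z\in\mathbb{R}^p$ with $z\sim N(0,\Sigma)$, where $\Sigma=\Sigma_{p,p}$ is a $p\times p$ covariance matrix with precision matrix $\Omega=\Omega_{p,p}=\Sigma^{-1}$, and $\Omega$ is known. The sequence $\Omega_{p,p}$ satisfies $\Omega(i,i)=1$ for all $1\le i\le p$, and, with $d_p^*(\Omega)=\max_{1\le i\le p}\#\{1\le j\le p:\Omega(i,j)\ne 0\}$, one has $d_p^*(\Omega)\,p^{-\delta}\to 0$ as $p\to\infty$ for every fixed $\delta>0$. The vector $\beta$ is random, independent of $z$, with $$\beta_i\overset{iid}{\sim}(1-\epsilon_p)\nu_0+\epsilon_p\nu_{\tau_p},\quad 1\le i\le p,$$ where $\nu_a$ is the point mass at $a$, $\epsilon_p=p^{-\vartheta}$,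 and $\tau_p=\sqrt{2r\log p}$. The testing problem is: under $H_0^{(p)}$, $\beta=0$ (so $Y\sim N(0,\Sigma)$); under $H_1^{(p)}$, $\beta$ is random with the distribution just described (so $Y$ has the resulting marginal distribution). The Type I error is the probability of rejecting $H_0^{(p)}$ under $H_0^{(p)}$, and the Type II error is the probability of not rejecting $H_0^{(p)}$ under $H_1^{(p)}$. The standard phase function for detection is $$\rho^*(\vartheta)=\begin{cases}0,&0<\vartheta\le 1/2,\\ \vartheta-1/2,&1/2<\vartheta\le 3/4,\\ (1-\sqrt{1-\vartheta})^2,&3/4<\vartheta<1.\end{cases}$$ *)

(* Defs.v *)
From HB Require Import structures.
From mathcomp Require Import all_boot all_order all_algebra.
From mathcomp Require Import all_classical all_reals all_analysis.

Set Implicit Arguments.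
Unset Strict Implicit.
Unset Printing Implicit Defensive.

Import Order.TTheory GRing.Theory Num.Theory.
Import numFieldNormedType.Exports.

Local Open Scope classical_set_scope.
Local Open Scope ring_scope.

(* Vectors of R^p are [p.-tuple R]: tuples (unlike matrices) carry the product
   sigma-algebra in the library. *)

Definition addt (R : realType) (p : nat) (x y : p.-tuple R) : p.-tuple R :=
  [tuple tnth x i + tnth y i | i < p].

Definition mulmxt (R : realType) (p : nat) (A : 'M[R]_p) (x : p.-tuple R) :
    p.-tuple R :=
  [tuple \sum_(j < p) A i j * tnth x j | i < p].

Section random_vectors.
Context (R : realType) (d : measure_display) (T : measurableType d)
  (P : probability T R) (p : nat).
Implicit Types X Y : {RV P >-> p.-tuple R}.

Definition has_law d' (T' : measurableType d') (X : {RV P >-> T'})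
    (mu : set T' -> \bar R) : Prop :=
  forall B : set T', measurable B -> distribution P X B = mu B.

(* Taking some of the [B i] to be [setT] gives the product rule for every
   subfamily of coordinates. *)
Definition mutually_independent X : Prop :=
  forall B : 'I_p -> set R, (forall i, measurable (B i)) ->
    P [set w | forall i, B i (tnth (X w) i)] =
    (\prod_(i < p) P [set w | B i (tnth (X w) i)])%E.

Definition identically_distributed X (mu : set R -> \bar R) : Prop :=
  forall (i : 'I_p) (B : set R), measurable B ->
    P [set w | B (tnth (X w) i)] = mu B.

Definition iid X (mu : set R -> \bar R) : Prop :=
  mutually_independent X /\ identically_distributed X mu.

Definition independent X Y : Prop :=
  forall A B : set (p.-tuple R), measurable A -> measurable B ->
    P (X @^-1` A `&` Y @^-1` B) = (P (X @^-1` A) * P (Y @^-1` B))%E.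

End random_vectors.

(* X ~ N(0, Sigma): X has the law of A G, where A A^T = Sigma and G is a vector
   of independent standard normal variables, possibly on another space. *)
Definition centered_gaussian (R : realType) (d : measure_display)
    (T : measurableType d) (P : probability T R) (p : nat)
    (X : {RV P >-> p.-tuple R}) (Sigma : 'M[R]_p) : Prop :=
  exists A : 'M[R]_p, A *m A^T = Sigma /\
  exists (d' : measure_display) (T' : measurableType d')
         (P' : probability T' R) (G : {RV P' >-> p.-tuple R}),
    iid G (normal_prob 0 1) /\
    has_law X (fun B => P' [set w | B (mulmxt A (G w))]).

Definition is_covariance (R : realType) (p : nat) (Sigma : 'M[R]_p) : Prop :=
  Sigma^T = Sigma /\ forall u : 'cV[R]_p, 0 <= (u^T *m Sigma *m u) 0 0.

Definition is_precision (R : realType) (p : nat) (Omega Sigma : 'M[R]_p) :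
    Prop :=
  Sigma \in unitmx /\ Omega = invmx Sigma.

Definition max_row_support (R : realType) (p : nat) (Omega : 'M[R]_p) : nat :=
  (\max_(i < p) #|[pred j : 'I_p | Omega i j != 0%R]|)%N.

Definition eps (R : realType) (theta : R) (p : nat) : R := p%:R `^ (- theta).

Definition tau (R : realType) (r : R) (p : nat) : R :=
  Num.sqrt (2 * r * ln p%:R).

Definition spike_law (R : realType) (theta r : R) (p : nat) (B : set R) :
    \bar R :=
  ((1 - eps theta p)%:E * \d_(0%R : R) B + (eps theta p)%:E * \d_(tau r p) B)%E.

(* The sequence of models ARW(theta, r, Omega), realised for each p by random
   vectors beta and z on some probability space. *)
Record ARW (R : realType) (theta r : R) (Sigma Omega : forall p, 'M[R]_p)
    (d : nat -> measure_display) (T : forall p, measurableType (d p))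
    (P : forall p, probability (T p) R)
    (beta z : forall p, {RV (P p) >-> p.-tuple R}) : Prop := {
  ARW_covariance : forall p, is_covariance (Sigma p);
  ARW_precision : forall p, is_precision (Omega p) (Sigma p);
  ARW_diag : forall p (i : 'I_p), Omega p i i = 1;
  ARW_sparse : forall delta : R, 0 < delta ->
    (max_row_support (Omega p))%:R * p%:R `^ (- delta) @[p --> \oo] --> 0;
  ARW_noise : forall p, centered_gaussian (z p) (Sigma p);
  ARW_signal : forall p, iid (beta p) (spike_law theta r p);
  ARW_indep : forall p, independent (beta p) (z p)
}.
Arguments ARW {R} theta r Sigma Omega {d T} P beta z.

Definition observation (R : realType) (p : nat) (T : Type)
    (beta z : T -> p.-tuple R) : T -> p.-tuple R :=
  fun w => addt (beta w) (z w).

Definition no_signal (R : realType) (p : nat) (T : Type) : T -> p.-tuple R :=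
  fun=> [tuple 0 | _ < p].

(* A test is given by its conditional probability of rejecting the null
   hypothesis given the observation; it is nonrandomized when this probability
   is always 0 or 1. *)
Definition is_test (R : realType) (p : nat) (phi : p.-tuple R -> R) : Prop :=
  measurable_fun setT phi /\ forall y, 0 <= phi y <= 1.

Definition nonrandomized (R : realType) (p : nat) (phi : p.-tuple R -> R) :
    Prop :=
  forall y, phi y = 0 \/ phi y = 1.

Definition type1_error (R : realType) (d : measure_display)
    (T : measurableType d) (P : probability T R) (p : nat)
    (z : {RV P >-> p.-tuple R}) (phi : p.-tuple R -> R) : \bar R :=
  'E_P[fun w => phi (observation (@no_signal R p T) z w)]%E.

Definition type2_error (R : realType) (d : measure_display)
    (T : measurableType d) (P : probability T R) (p : nat)
    (beta z : {RV P >-> p.-tuple R}) (phi : p.-tuple R -> R) : \bar R :=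
  'E_P[fun w => (1 - phi (observation beta z w))%R]%E.
Arguments type1_error {R d T} P {p} z phi.
Arguments type2_error {R d T} P {p} beta z phi.

Definition rho_star (R : realType) (theta : R) : R :=
  if theta <= 2^-1 then 0
  else if theta <= 3 / 4 then theta - 2^-1
  else (1 - Num.sqrt (1 - theta)) ^+ 2.

(* Main.v *)
From HB Require Import structures.
Require Import Defs.
From mathcomp Require Import all_boot all_order all_algebra.
From mathcomp Require Import all_classical all_reals all_analysis.
From mathcomp Require Import measurable_realfun ring lra.

(** The observation [Y] is replaced by [X = Omega Y], whose noise [Omega z] is
    Gaussian with covariance [Omega]: since [Omega] has unit diagonal and few
    nonzero entries per row, every coordinate of the noise is standard normal and
    is correlated with few others, while an isolated signal shifts its own
    coordinate by exactly [tau]. Call two coordinates neighbours when their entry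
    of [Omega] is nonzero. Up to factors that are smaller than any power of [p],
    the problem behaves as if the coordinates of [X] were independent.

    All facts about Gaussian vectors come from the Cameron--Martin formula
    ([gaussian_shift]), which is proved one coordinate at a time for a vector of
    independent standard normals and carried over to [z] by a linear map. It gives
    the exponential moments of linear functionals of [X] ([innovation_mgf]), the
    likelihood ratio of a fixed signal ([shift_spike]) and, by integrating over
    all translations, the normality and the independence of uncorrelated
    coordinates ([normal_of_shift], [innovation_indep]).

    Below the boundary, which forces [theta > 1 / 2], with high probability no two
    distinct signals have a common neighbour; such supports are called scattered. Let [L]
    be the likelihood ratio averaged over scattered supports only, each term being
    cut to zero when a signal coordinate of [X] exceeds [sqrt (2 ln p)]. Cutting
    loses little mass ([mixture_lr_mass]) and makes the second moment of [L] close
    to one up to the boundary ([mixture_lr_second_moment]): for two independent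
    scattered supports the edges between them form a matching, each matched pair
    contributes no more than Chernoff's bound on the second moment of a single
    truncated ratio, and the expectation over supports factorises ([sum_weight_edges]). Since
    [E |1 - L|] is then small and [L] is dominated by the true likelihood ratio,
    no test separates the hypotheses ([null_vs_mixture], [risk_near_one]).

    Above the boundary the test counts the coordinates of [X] above
    [kappa * sqrt (2 ln p)] with [kappa = min (2 * sqrt r, 1)]. Coordinates without a
    common neighbour are independent under both hypotheses, so the variance of the
    count is at most its mean times the square of the maximal row support
    ([count_chebyshev]). Isolated signals raise the mean by about the expected
    number of signals above the threshold ([mean_count_ge]), which is larger than
    the standard deviation by a power of [p] ([near_count_separation]). *)

Set Implicit Arguments.
Unset Strict Implicit.
Unset Printing Implicit Defensive.

Import Order.TTheory GRing.Theory Num.Theory.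
Import numFieldNormedType.Exports.
Import HBNNSimple.

Local Open Scope classical_set_scope.
Local Open Scope ring_scope.

(** * Measures with a density, and the standard normal law *)

(** The two properties of [f] are parameters so that a measure structure can be
    inferred from the term. *)
Definition mdensity (R : realType) (d : measure_display)
    (T : measurableType d) (mu : {measure set T -> \bar R}) (f : T -> R)
    (mf : measurable_fun setT f) (f0 : forall x, 0 <= f x)
    (A : set T) : \bar R :=
  (\int[mu]_(x in A) (f x)%:E)%E.

Section density.
Context (R : realType) (d : measure_display) (T : measurableType d)
  (mu : {measure set T -> \bar R}) (f : T -> R)
  (mf : measurable_fun setT f) (f0 : forall x, 0 <= f x).
Local Open Scope ereal_scope.
Local Notation nu := (mdensity mu mf f0).

Let nu0 : nu set0 = 0.
Proof. by rewrite /mdensity integral_set0. Qed.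

Let nu_ge0 A : 0 <= nu A.
Proof. by apply: integral_ge0 => x _; rewrite lee_fin. Qed.

Let nu_sigma_additive : semi_sigma_additive nu.
Proof.
move=> /= A mA tA mUA.
rewrite /mdensity/= ge0_integral_bigcup//=; last 2 first.
- by apply: measurable_funTS; apply/measurable_EFinP.
- by move=> x _; rewrite lee_fin.
apply: is_cvg_ereal_nneg_natsum_cond => n _ _.
by apply: integral_ge0 => /= x ?; rewrite lee_fin.
Qed.

HB.instance Definition _ := isMeasure.Build _ _ _
  nu nu0 nu_ge0 nu_sigma_additive.

(** Both sides are monotone limits along simple functions approximating [g],
    and on an indicator the identity is the definition of the density measure. *)
Lemma integral_mdensity (g : T -> \bar R) :
  measurable_fun setT g -> (forall x, 0 <= g x) ->
  \int[nu]_x g x = \int[mu]_x (g x * (f x)%:E).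
Proof.
move=> mg g0; pose g_ := nnsfun_approx measurableT mg.
have cg x : (g_ n x)%:E @[n --> \oo] --> g x by exact: cvg_nnsfun_approx.
have mgf n : measurable_fun setT (fun x => (g_ n x)%:E * (f x)%:E).
  by apply: emeasurable_funM; apply/measurable_EFinP => //.
transitivity (limn (fun n => \int[nu]_x (g_ n x)%:E)).
  rewrite -monotone_convergence//.
  - by apply: eq_integral => x _; apply/esym/cvg_lim.
  - by move=> n; exact/measurable_EFinP/measurable_funP.
  - by move=> n y _; rewrite lee_fin.
  - by move=> y _ m n mn; rewrite lee_fin; exact/lefP/nd_nnsfun_approx.
transitivity (limn (fun n => \int[mu]_x ((g_ n x)%:E * (f x)%:E))); last first.
  rewrite -monotone_convergence//.
  - apply: eq_integral => x _; apply/cvg_lim => //.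
    by apply: cvgeZr => //; exact: cg.
  - by move=> n x _; rewrite mule_ge0 ?lee_fin.
  - move=> y _ m n mn; rewrite lee_wpmul2r ?lee_fin//.
    exact/lefP/nd_nnsfun_approx.
congr (limn _); apply/funext => n.
under [LHS]eq_integral do rewrite fimfunE -fsumEFin//.

rewrite [LHS]ge0_integral_fsum//; last 2 first.
- by move=> r; apply/measurable_EFinP/measurable_funM.
- by move=> r y _; rewrite nnfun_muleindic_ge0.
under [RHS]eq_integral.
  move=> x _; rewrite fimfunE -fsumEFin// ge0_mule_fsuml; last first.
    by move=> r; rewrite nnfun_muleindic_ge0.
  over.
rewrite [RHS]ge0_integral_fsum//; last 2 first.
- move=> r; apply: emeasurable_funM; apply/measurable_EFinP => //.
  exact/measurable_funM.
- by move=> r y _; rewrite mule_ge0 ?lee_fin// -lee_fin nnfun_muleindic_ge0.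
apply: eq_fsbigr => r /[!inE] -[t _ <-].
have gt0 : (0 <= g_ n t)%R by [].
have mgt : measurable (g_ n @^-1` [set g_ n t]) by exact: measurable_sfunP.
rewrite integralZl_indic_nnsfun// integral_indic// setIT.
under [RHS]eq_integral do rewrite EFinM -muleA.
rewrite ge0_integralZl_EFin//=; last 2 first.
- by move=> x _; rewrite mule_ge0 ?lee_fin.
- by apply: emeasurable_funM; apply/measurable_EFinP.
congr (_ * _); rewrite /mdensity integral_mkcond; apply: eq_integral => x _.
by rewrite patchE indicE; case: ifPn; rewrite ?mul1e ?mul0e.
Qed.

End density.

Section normal.
Context (R : realType).
Local Open Scope ereal_scope.
Local Notation leb := (@lebesgue_measure R).
Local Notation N01 := (@normal_prob R 0 1).
Local Notation pdf := (@normal_pdf R 0 1).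

Lemma ge0_integral_translation (h : R) (f : R -> \bar R) :
  measurable_fun setT f -> (forall x, 0 <= f x) ->
  \int[leb]_x f (x + h)%R = \int[leb]_x f x.
Proof.
move=> mf f0.
pose sh (x : measurableTypeR R) : measurableTypeR R := (x + h)%R.
have msh : measurable_fun setT sh by exact: measurable_funD.
have leb_sh A : measurable A -> pushforward leb sh A = leb A.
  move=> mA; apply/esym/lebesgue_measure_unique => //= _ [[a b]] _ <-.
  rewrite /pushforward (_ : _ @^-1` _ = `](a - h)%R, (b - h)%R]%classic); last first.
    by apply/seteqP; split => x/=; rewrite !in_itv/= ltrBlDr lerBrDr.
  rewrite !lebesgue_measure_itv/= !lte_fin ltrD2r.
  by case: ifP => // _; rewrite -!EFinD; congr EFin; ring.
transitivity (\int[pushforward leb sh]_x f x).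
  by rewrite (ge0_integral_pushforward msh)// => x _.
by apply: eq_measure_integral => //= A mA _; exact: leb_sh.
Qed.

(** Completing the square in the exponent: tilting the standard normal density
    by an exponential recentres it. *)
Lemma normal_pdf_tilt (h x : R) :
  (pdf (x - h) = pdf x * expR (h * x - h ^+ 2 / 2))%R.
Proof.
rewrite normal_pdfE ?oner_neq0//= -mulrA; congr (_ * _)%R.
rewrite /normal_fun -expRD; congr expR; by field.
Qed.

Lemma integral_normal01 (g : R -> \bar R) :
  measurable_fun setT g -> (forall x, 0 <= g x) ->
  \int[N01]_x g x = \int[leb]_x (g x * (pdf x)%:E).
Proof.
move=> mg g0; have mpdf := @measurable_normal_pdf R 0 1.
by rewrite -(integral_mdensity leb mpdf (normal_pdf_ge0 0 1)).
Qed.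

(** The Cameron--Martin formula in dimension one. *)
Lemma normal01_shift (h : R) (g : R -> \bar R) :
  measurable_fun setT g -> (forall x, 0 <= g x) ->
  \int[N01]_x g (x + h)%R = \int[N01]_x (g x * (expR (h * x - h ^+ 2 / 2))%:E).
Proof.
move=> mg g0.
have mpdf := @measurable_normal_pdf R 0 1.
have mexp : measurable_fun setT (fun x : R => expR (h * x - h ^+ 2 / 2)).
  by apply: measurableT_comp => //; apply: measurable_funB.
have mgh : measurable_fun setT (fun x : R => g (x + h)%R).
  by apply: measurableT_comp => //; exact: measurable_funD.
have mge : measurable_fun setT
    (fun x : R => g x * (expR (h * x - h ^+ 2 / 2))%:E).
  by apply: emeasurable_funM => //; apply/measurable_EFinP.
have ge0 x : 0 <= g x * (expR (h * x - h ^+ 2 / 2))%:E.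
  by rewrite mule_ge0// lee_fin expR_ge0.
rewrite (integral_normal01 mgh)// (integral_normal01 mge)//.
pose f x : \bar R := g x * (pdf (x - h)%R)%:E.
have mf : measurable_fun setT f.
  apply: emeasurable_funM => //; apply/measurable_EFinP.
  by apply: measurableT_comp => //; exact: measurable_funB.
have f0 x : 0 <= f x by rewrite mule_ge0// lee_fin normal_pdf_ge0.
transitivity (\int[leb]_x f (x + h)%R).
  by apply: eq_integral => x _; rewrite /f addrK.
rewrite (ge0_integral_translation h mf f0); apply: eq_integral => x _.
by rewrite /f -muleA -EFinM normal_pdf_tilt [X in _ * X%:E]mulrC.
Qed.

(** As a function of [h] the integrand is the normal density centred at [x]. This
    is where the normal density comes from in [normal_of_shift]. *)
Lemma integral_expR_tilt (x : R) :
  \int[leb]_h (expR (h * x - h ^+ 2 / 2) * pdf x)%:E = 1.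
Proof.
under eq_integral do rewrite mulrC -normal_pdf_tilt.
rewrite -(integral_normal_pdf x 1); apply: eq_integral => h _.
rewrite !normal_pdfE ?oner_neq0// /normal_fun; congr (_ * expR _)%:E; by field.
Qed.

End normal.

(** * Translations of a Gaussian vector *)

(** The hypothesis says that [U] pushes the restriction of [mu] to [E] forward to
    the measure [c nu]; with [c = mu E] it expresses independence. *)
Lemma integral_indep_event (R : realType) (d d' : measure_display)
    (T : measurableType d) (T' : measurableType d')
    (mu : {measure set T -> \bar R}) (nu : {measure set T' -> \bar R})
    (E : set T) (U : T -> T') (c : R) (g : T' -> \bar R) :
  measurable E -> measurable_fun setT U -> 0 <= c ->
  (forall C, measurable C -> mu (E `&` U @^-1` C) = (c%:E * nu C)%E) ->
  measurable_fun setT g -> (forall x, 0 <= g x)%E ->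
  (\int[mu]_x (g (U x) * (\1_E x)%:E) = c%:E * \int[nu]_x g x)%E.
Proof.
move=> mE mU c0 muE mg g0.
have m1E : measurable_fun setT (\1_E : T -> R) by exact: measurable_indic.
have E0 x : 0 <= (\1_E x : R) by [].
have mgU : measurable_fun setT (fun x => g (U x)) by exact: measurableT_comp.
rewrite -(integral_mdensity mu m1E E0)//.
transitivity (\int[pushforward (mdensity mu m1E E0) U]_x g x)%E.
  by rewrite (ge0_integral_pushforward mU).
transitivity (\int[mscale (NngNum c0) nu]_x g x)%E; last first.
  by rewrite ge0_integral_mscale.
apply: eq_measure_integral => //= C mC _.
have mUC : measurable (U @^-1` C) by rewrite -[X in measurable X]setTI; exact: mU.
rewrite /pushforward /mdensity integral_indic//; exact: muE.
Qed.

(** The sigma-algebra of tuples is generated by products of measurable sets, so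
    finite measures on tuples are determined by their values on boxes. *)
Section tuple_boxes.
Context (R : realType) (p : nat).
Implicit Types B : 'I_p -> set R.

Definition box B : set (p.-tuple R) := [set x | forall i, B i (tnth x i)].

Lemma measurable_box B : (forall i, measurable (B i)) -> measurable (box B).
Proof.
move=> mB; rewrite (_ : box B = \bigcap_(i in [set: 'I_p]) ((@tnth p R)^~ i @^-1` B i)).
  apply: fin_bigcap_measurable => // i _.
  by rewrite -[X in measurable X]setTI; exact: measurable_tnth.
by apply/seteqP; split => [x Bx i _|x Bx i]; [exact: Bx|exact: Bx].
Qed.

Definition boxes : set (set (p.-tuple R)) :=
  [set A | exists2 B, (forall i, measurable (B i)) & A = box B].

Lemma measurable_boxesE : measurable = <<s boxes >>.
Proof.
apply/seteqP; split; last first.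
  apply: smallest_sub; first exact: sigma_algebra_measurable.
  by move=> _ [B mB ->]; exact: measurable_box.
apply: smallest_sub; first exact: smallest_sigma_algebra.
move=> A; rewrite -bigcup_seq/= => -[i _ [C mC <-]].
apply: sub_sigma_algebra; exists (fun j => if j == i then C else setT).
  by move=> j; case: ifP.
apply/seteqP; split => [x [_ Cx] j /=|x Bx]; first by case: eqP => [->|].
by split => //; have := Bx i; rewrite /= eqxx.
Qed.

Lemma boxes_setI : setI_closed boxes.
Proof.
move=> _ _ [B mB ->] [C mC ->]; exists (fun i => B i `&` C i).
  by move=> i; exact: measurableI.
apply/seteqP; split => [x [Bx Cx] i|x BCx]; first by split; [exact: Bx|exact: Cx].
by split => i; have [] := BCx i.
Qed.

Lemma box_measure_unique (m1 m2 : {measure set (p.-tuple R) -> \bar R}) :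
  (m1 setT < +oo)%E ->
  (forall B, (forall i, measurable (B i)) -> m1 (box B) = m2 (box B)) ->
  forall A, measurable A -> m1 A = m2 A.
Proof.
move=> m1T m12 A mA; apply: (measure_unique boxes (fun=> setT)) => //.
- exact: measurable_boxesE.
- exact: boxes_setI.
- by move=> _; exists (fun=> setT) => //; apply/seteqP; split.
- by apply/seteqP; split => // x _; exists 0%N.
- by move=> _ [B mB ->]; exact: m12.
Qed.

End tuple_boxes.

Definition single (R : realType) (p : nat) (k : 'I_p) (h : R) : p.-tuple R :=
  [tuple if i == k then h else 0 | i < p].

Lemma measurable_fun_addt (R : realType) (d : measure_display)
    (T : measurableType d) (p : nat) (f g : T -> p.-tuple R) :
  measurable_fun setT f -> measurable_fun setT g ->
  measurable_fun setT (fun w => addt (f w) (g w)).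
Proof.
move=> mf mg; apply/measurable_fun_tnthP => i.
rewrite (_ : _ \o _ = fun w => tnth (f w) i + tnth (g w) i); last first.
  by apply/funext => w /=; rewrite tnth_mktuple.
by apply: measurable_funD; apply: (measurableT_comp (measurable_tnth i)).
Qed.

Lemma measurable_addt (R : realType) (p : nat) (a : p.-tuple R) :
  measurable_fun setT (addt a).
Proof. exact: (measurable_fun_addt (measurable_cst a) (@measurable_id _ _ setT)). Qed.

Lemma measurable_mulmxt (R : realType) (p : nat) (A : 'M[R]_p) :
  measurable_fun setT (mulmxt A).
Proof.
apply/measurable_fun_tnthP => i /=.
rewrite (_ : _ \o _ = fun x : p.-tuple R => \sum_(j < p) A i j * tnth x j).
  apply: measurable_sum => j; apply: measurable_funM => //.
  exact: measurable_tnth.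
by apply/funext => x /=; rewrite tnth_mktuple.
Qed.

Section iid_normal_shift.
Context (R : realType) (d : measure_display) (T : measurableType d)
  (P : probability T R) (p : nat) (G : {RV P >-> p.-tuple R}).
Hypothesis iidG : iid G (normal_prob 0 1).
Local Notation N01 := (@normal_prob R 0 1).

(* The factor of the Cameron--Martin density carried by coordinate [k]. *)
Let tilt (k : 'I_p) (h : R) (x : p.-tuple R) :=
  expR (h * tnth x k - h ^+ 2 / 2).

Let measurable_tilt k h : measurable_fun setT (tilt k h).
Proof.
apply: measurableT_comp => //; apply: measurable_funB => //.
by apply: measurable_funM => //; exact: measurable_tnth.
Qed.

Let iid_box (B : 'I_p -> set R) : (forall i, measurable (B i)) ->
  P (G @^-1` box B) = (\prod_(i < p) N01 (B i))%E.
Proof.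
move=> mB; have [indG idG] := iidG.
by rewrite (indG _ mB); apply: eq_bigr => i _; exact: idG.
Qed.

Let G_measurable : measurable_fun setT G.
Proof. exact: measurable_funPT. Qed.

(** It suffices to compare both sides on boxes, where independence reduces the
    claim to the one-dimensional [normal01_shift] in coordinate [k]. *)
Lemma iid_normal_shift1 (k : 'I_p) (h : R) (psi : p.-tuple R -> \bar R) :
  measurable_fun setT psi -> (forall x, 0 <= psi x)%E ->
  (\int[P]_w psi (addt (single k h) (G w)) =
   \int[P]_w (psi (G w) * (tilt k h (G w))%:E))%E.
Proof.
move=> mpsi psi0.
have tilt0 x : 0 <= tilt k h x by exact: expR_ge0.
have mG := G_measurable; have madd := measurable_addt (single k h).
have maddG : measurable_fun setT (addt (single k h) \o G).
  exact: measurableT_comp.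
transitivity (\int[pushforward P (addt (single k h) \o G)]_x psi x)%E.
  by rewrite (ge0_integral_pushforward maddG).
transitivity (\int[mdensity (distribution P G) (measurable_tilt k h) tilt0]_x psi x)%E;
  last first.
  rewrite integral_mdensity// ge0_integral_distribution//.
    by apply: emeasurable_funM => //; apply/measurable_EFinP.
  by move=> y; rewrite mule_ge0// lee_fin.
apply: eq_measure_integral => A mA _.
apply: box_measure_unique => //.
  by rewrite /= /pushforward preimage_setT probability_setT ltry.
move=> B mB.
pose B' i := if i == k then (fun x => x + h) @^-1` (B i) else B i.
have mB' i : measurable (B' i).
  rewrite /B'; case: ifP => // _.
  rewrite -[X in measurable X]setTI.
  by apply: (@measurable_funD _ _ R setT id (cst h)).
transitivity (P (G @^-1` box B')).
  rewrite /= /pushforward; congr (P _); apply/seteqP.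
  split => w /= H i; have := H i; rewrite /B' /addt tnth_mktuple /single tnth_mktuple;
  by case: eqP => // _; rewrite ?add0r // addrC.
rewrite iid_box//.
(* The constraints on the coordinates other than [k] split off as an event that
   is independent of coordinate [k]. *)
pose E := box (fun i => if i == k then setT else B i).
have mE : measurable E by apply: measurable_box => i; case: ifP.
pose c := fine (\prod_(i < p | i != k) N01 (B i))%E.
have cE : (c%:E = \prod_(i < p | i != k) N01 (B i))%E.
  rewrite fineK// prode_fin_num// => i _.
  exact: (fin_num_measure (normal_prob 0 1 : probability (measurableTypeR R) R) _ (mB i)).
have c0 : 0 <= c.
  by rewrite -lee_fin cE; apply: prode_ge0 => i _; apply: (measure_ge0 (normal_prob 0 1)).
have bE : forall C, measurable C ->
    distribution P G (E `&` (fun x => tnth x k) @^-1` C) = (c%:E * N01 C)%E.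
  move=> C mC.
  have -> : E `&` (fun x => tnth x k) @^-1` C = box (fun i => if i == k then C else B i).
    apply/seteqP; split => [x [Ex Cx] i|x Bx].
      by have := Ex i; case: eqP => // ->.
    split; last by have := Bx k; rewrite eqxx.
    by move=> i; have := Bx i; case: eqP.
  rewrite /distribution /pushforward iid_box; last by move=> i; case: ifP.
  rewrite (bigD1 k)//= eqxx muleC cE; congr (_ * _)%E.
  by apply: eq_bigr => i /negbTE ->.
have mtilt1 : measurable_fun setT (fun x : R => expR (h * x - h ^+ 2 / 2)).
  by apply: measurableT_comp => //; apply: measurable_funB.
pose g x := ((\1_(B k) x)%:E * (expR (h * x - h ^+ 2 / 2))%:E)%E.
have mg : measurable_fun setT g.
  by apply: emeasurable_funM; apply/measurable_EFinP => //; exact: measurable_indic.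
have g0 x : (0 <= g x)%E by rewrite mule_ge0// lee_fin ?expR_ge0.
transitivity (\int[distribution P G]_x (g (tnth x k) * (\1_E x)%:E))%E; last first.
  rewrite /= /mdensity [RHS]integral_mkcond; apply: eq_integral => x _.
  have xE : (x \in box B) = (tnth x k \in B k) && (x \in E).
    apply/idP/idP => [|/andP[]]; rewrite !inE.
      move=> Bx; apply/andP; split; rewrite inE; first exact: Bx.
      by move=> i; case: ifP => // _; exact: Bx.
    by move=> Bk Ex i; have := Ex i; case: eqP => [->|].
  rewrite patchE xE /g !indicE.
  by case: (_ \in B k); case: (x \in E); rewrite ?mul1e ?mul0e ?mule1 ?mule0.
rewrite (@integral_indep_event _ _ _ _ (measurableTypeR R) (distribution P G)
  (normal_prob 0 1) E (fun x => tnth x k) c g mE (@measurable_tnth _ R p k) c0 bE)//.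
rewrite -normal01_shift//; last by apply/measurable_EFinP; exact: measurable_indic.
rewrite (bigD1 k)//= muleC; congr (_ * _)%E.
  by rewrite cE; apply: eq_bigr => i /negbTE ik; rewrite /B' ik.
have := mB' k; rewrite /B' eqxx => mBk.
by rewrite integral_indic ?setIT.
Qed.

(** The general translation is a composition of one translation per coordinate;
    the tilt of coordinate [k] is not affected by the translations of the
    others. *)
Lemma iid_normal_shift (h : p.-tuple R) (psi : p.-tuple R -> \bar R) :
  measurable_fun setT psi -> (forall x, 0 <= psi x)%E ->
  (\int[P]_w psi (addt h (G w)) =
   \int[P]_w (psi (G w) *
     (expR (\sum_(i < p) (tnth h i * tnth (G w) i - tnth h i ^+ 2 / 2)))%:E))%E.
Proof.
move=> mpsi psi0.
pose part (s : seq 'I_p) : p.-tuple R :=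
  [tuple if i \in s then tnth h i else 0 | i < p].
(* [part s] translates the coordinates in [s] only. *)
suff main (s : seq 'I_p) : uniq s -> forall f : p.-tuple R -> \bar R,
    measurable_fun setT f -> (forall x, 0 <= f x)%E ->
    (\int[P]_w f (addt (part s) (G w)) =
     \int[P]_w (f (G w) * (\prod_(i <- s) tilt i (tnth h i) (G w))%:E))%E.
  have -> : h = part (index_enum 'I_p).
    by apply: eq_from_tnth => i; rewrite tnth_mktuple mem_index_enum.
  rewrite main ?index_enum_uniq//; apply: eq_integral => w _.
  rewrite expR_sum; congr (_ * _%:E)%E; apply: eq_bigr => i _.
  by rewrite /tilt /part tnth_mktuple mem_index_enum.
elim: s => [_|k s IH /= /andP[ks us]] f mf f0.
  apply: eq_integral => w _; rewrite big_nil mule1; congr f.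
  by apply: eq_from_tnth => i; rewrite !tnth_mktuple add0r.
have partE x : addt (part (k :: s)) x = addt (part s) (addt (single k (tnth h k)) x).
  apply: eq_from_tnth => i; rewrite !tnth_mktuple inE.
  by have [->|_] := eqVneq i k; rewrite ?(negbTE ks) /= ?add0r.
under eq_integral do rewrite partE.
rewrite (@iid_normal_shift1 k (tnth h k) (fun x => f (addt (part s) x)))//; last first.
  by apply: measurableT_comp => //; exact: measurable_addt.
pose f' x := (f x * (tilt k (tnth h k) x)%:E)%E.
transitivity (\int[P]_w f' (addt (part s) (G w)))%E.
  apply: eq_integral => w _; rewrite /f' /tilt !tnth_mktuple (negbTE ks).
  by rewrite add0r.
rewrite IH//; last 2 first.
- by apply: emeasurable_funM => //; apply/measurable_EFinP; exact: measurable_tilt.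
- by move=> x; rewrite mule_ge0// lee_fin expR_ge0.
by apply: eq_integral => w _; rewrite big_cons /f' -muleA -EFinM.
Qed.

End iid_normal_shift.

(** Cameron--Martin formula in the coordinates [Omega z]: translating the noise
    by [a] tilts its law by an exponential of a linear functional of
    [Omega z]. *)
Definition gaussian_shift (R : realType) (d : measure_display)
    (T : measurableType d) (P : probability T R) (p : nat)
    (z : {RV P >-> p.-tuple R}) (Omega : 'M[R]_p) : Prop :=
  forall (a : p.-tuple R) (psi : p.-tuple R -> \bar R),
    measurable_fun setT psi -> (forall x, 0 <= psi x)%E ->
    (\int[P]_w psi (addt a (z w)) =
     \int[P]_w (psi (z w) *
       (expR (\sum_(i < p) tnth a i * tnth (mulmxt Omega (z w)) i -
              (\sum_(i < p) tnth a i * tnth (mulmxt Omega a) i) / 2))%:E))%E.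

Definition colt (R : realType) (p : nat) (x : p.-tuple R) : 'cV[R]_p :=
  \col_i tnth x i.

Lemma tnth_mulmxt (R : realType) (p : nat) (A : 'M[R]_p) (x : p.-tuple R) i :
  tnth (mulmxt A x) i = (A *m colt x) i 0.
Proof. by rewrite tnth_mktuple mxE; apply: eq_bigr => j _; rewrite mxE. Qed.

Lemma colt_mulmxt (R : realType) (p : nat) (A : 'M[R]_p) (x : p.-tuple R) :
  colt (mulmxt A x) = A *m colt x.
Proof. by apply/colP => i; rewrite mxE tnth_mulmxt. Qed.

Lemma colt_inj (R : realType) (p : nat) : injective (@colt R p).
Proof.
move=> x y xy; apply: eq_from_tnth => i.
by move/colP/(_ i) : xy; rewrite !mxE.
Qed.

Lemma colt_addt (R : realType) (p : nat) (x y : p.-tuple R) :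
  colt (addt x y) = colt x + colt y.
Proof. by apply/colP => i; rewrite !mxE tnth_mktuple. Qed.

Lemma dott (R : realType) (p : nat) (x y : p.-tuple R) :
  \sum_(i < p) tnth x i * tnth y i = ((colt x)^T *m colt y) 0 0.
Proof. by rewrite mxE; apply: eq_bigr => i _; rewrite !mxE. Qed.

(** For [z = A G] a translation of [z] by [a] is one of [G] by the inverse of [A]
    applied to [a], and [Omega] is the Gram matrix of the inverse of [A]. *)
Lemma centered_gaussian_shift (R : realType) (d : measure_display)
    (T : measurableType d) (P : probability T R) (p : nat)
    (z : {RV P >-> p.-tuple R}) (Sigma Omega : 'M[R]_p) :
  is_precision Omega Sigma -> centered_gaussian z Sigma ->
  gaussian_shift z Omega.
Proof.
move=> [uS ->] [A [AA [d' [T' [P' [G [iidG lawz]]]]]]] a psi mpsi psi0.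
have [uA uAT] : A \in unitmx /\ A^T \in unitmx.
  by apply/andP; rewrite -unitmx_mul AA.
have invS : invmx Sigma = invmx A^T *m invmx A.
  apply: (can_inj (mulKmx uS)); rewrite mulmxV// -AA -mulmxA.
  by rewrite mulKVmx// mulmxV.
have mA := measurable_mulmxt A.
have mG : measurable_fun setT G by exact: measurable_funPT.
have transfer (f : p.-tuple R -> \bar R) : measurable_fun setT f ->
    (forall x, 0 <= f x)%E ->
    (\int[P]_w f (z w) = \int[P']_w f (mulmxt A (G w)))%E.
  move=> mf f0.
  rewrite -(ge0_integral_distribution z mf f0).
  have mAG : measurable_fun setT (mulmxt A \o G) by exact: measurableT_comp.
  transitivity (\int[pushforward P' (mulmxt A \o G)]_y f y)%E.
    by apply: eq_measure_integral => //= B mB _; exact: lawz.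
  by rewrite (ge0_integral_pushforward mAG).
have madd := measurable_addt a.
have mOm := measurable_mulmxt (invmx Sigma).
rewrite (transfer (fun x => psi (addt a x)))//; last exact: measurableT_comp.
pose tilted x := (psi x * (expR (\sum_(i < p) tnth a i *
  tnth (mulmxt (invmx Sigma) x) i -
  (\sum_(i < p) tnth a i * tnth (mulmxt (invmx Sigma) a) i) / 2))%:E)%E.
have mtilted : measurable_fun setT tilted.
  apply: emeasurable_funM => //; apply/measurable_EFinP.
  apply: measurableT_comp => //; apply: measurable_funB => //.
  apply: measurable_sum => i; apply: measurable_funM => //.
  exact: (measurableT_comp (measurable_tnth i) mOm).
rewrite (transfer tilted)//; last by move=> x; rewrite mule_ge0// lee_fin expR_ge0.
pose h := mulmxt (invmx A) a.
have hE x : addt a (mulmxt A x) = mulmxt A (addt h x).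
  apply: colt_inj; rewrite colt_mulmxt !colt_addt !colt_mulmxt mulmxDr.
  by rewrite mulKVmx.
pose phi x := psi (mulmxt A x).
have mphi : measurable_fun setT phi by exact: measurableT_comp.
transitivity (\int[P']_w phi (addt h (G w)))%E.
  by apply: eq_integral => w _; rewrite hE.
rewrite (iid_normal_shift iidG h mphi (fun x => psi0 _)).
apply: eq_integral => w _; congr (_ * (expR _)%:E)%E.
rewrite sumrB -mulr_suml; congr (_ - _ / 2).
  rewrite !dott !colt_mulmxt invS trmx_mul trmx_inv -!mulmxA.
  by rewrite (mulmxA (invmx A)) mulVmx// mul1mx.
under eq_bigr do rewrite expr2.
by rewrite !dott !colt_mulmxt invS trmx_mul trmx_inv -!mulmxA.
Qed.

(** * The normal law recovered from its translations *)

(** The converse of the Cameron--Martin formula on the line. Integrating the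
    hypothesis over all translations [h], Tonelli's theorem turns the left-hand
    side into a Lebesgue integral and the right-hand side into an integral
    against the reciprocal of the normal density, whatever the law of [U]. *)
Lemma normal_of_shift (R : realType) (d : measure_display)
    (T : measurableType d) (P : probability T R) (U : T -> R) (E : set T) :
  measurable_fun setT U -> measurable E ->
  (forall (h : R) (f : R -> \bar R), measurable_fun setT f ->
    (forall x, 0 <= f x)%E ->
    (\int[P]_w (f (U w + h)%R * (\1_E w)%:E) =
     \int[P]_w (f (U w) * (\1_E w)%:E * (expR (h * U w - h ^+ 2 / 2))%:E))%E) ->
  forall C, measurable C ->
    P (E `&` U @^-1` C) = (P E * normal_prob 0 1 C)%E.
Proof.
move=> mU mE shiftU C mC.
have mpdf := @measurable_normal_pdf R 0 1.
have m1C : measurable_fun setT (\1_C : R -> R) by exact: measurable_indic.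
have m1E : measurable_fun setT (\1_E : T -> R) by exact: measurable_indic.
(* The factor [normal_pdf] is cancelled by the integral of the tilt over [h]. *)
pose f x : \bar R := (\1_C x * normal_pdf 0 1 x)%:E.
have mf : measurable_fun setT f by apply/measurable_EFinP; exact: measurable_funM.
have f0 x : (0 <= f x)%E by rewrite lee_fin mulr_ge0// normal_pdf_ge0.
have mU2 : measurable_fun setT (fun z : measurableTypeR R * T => U z.2).
  exact: measurableT_comp.
pose F (z : measurableTypeR R * T) := (f (U z.2 + z.1)%R * (\1_E z.2)%:E)%E.
pose H (z : measurableTypeR R * T) := (f (U z.2) * (\1_E z.2)%:E
  * (expR (z.1 * U z.2 - z.1 ^+ 2 / 2))%:E)%E.
have m1E2 : measurable_fun setT (fun z : measurableTypeR R * T => (\1_E z.2)%:E : \bar R).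
  by apply/measurable_EFinP; apply: measurableT_comp.
have mF : measurable_fun setT F.
  apply: emeasurable_funM => //.
  by apply: (measurableT_comp mf); apply: measurable_funD.
have mH : measurable_fun setT H.
  apply: emeasurable_funM; first apply: emeasurable_funM => //.
    exact: (measurableT_comp mf).
  apply/measurable_EFinP; apply: measurableT_comp => //.
  apply: measurable_funB; first exact: measurable_funM.
  by apply: measurable_funM => //; apply: measurable_funX.
have F0 z : (0 <= F z)%E by rewrite mule_ge0// lee_fin.
have H0 z : (0 <= H z)%E by rewrite !mule_ge0// lee_fin expR_ge0.
have : (\int[lebesgue_measure]_h \int[P]_w F (h, w) =
        \int[lebesgue_measure]_h \int[P]_w H (h, w))%E.
  by apply: eq_integral => h _; exact: shiftU.
have -> : (\int[lebesgue_measure]_h \int[P]_w F (h, w) =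
  \int[P]_w \int[lebesgue_measure]_h F (h, w))%E.
  exact: fubini_tonelli.
have -> : (\int[lebesgue_measure]_h \int[P]_w H (h, w) =
  \int[P]_w \int[lebesgue_measure]_h H (h, w))%E.
  exact: fubini_tonelli.
have NC : (\int[lebesgue_measure]_x f x = normal_prob 0 1 C)%E.
  rewrite /normal_prob [RHS]integral_mkcond; apply: eq_integral => x _.
  by rewrite /f patchE indicE; case: (x \in C); rewrite ?mul1r ?mul0r.
have innerF w : (\int[lebesgue_measure]_h F (h, w) =
    normal_prob 0 1 C * (\1_E w)%:E)%E.
  rewrite /F/= ge0_integralZr//; last first.
    by apply: (@measurableT_comp _ _ _ _ _ _ f) => //; exact: measurable_funD.
  congr (_ * _)%E; rewrite -NC -(ge0_integral_translation (U w) mf f0).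
  by apply: eq_integral => h _; rewrite addrC.
have innerH w : (\int[lebesgue_measure]_h H (h, w) =
    (\1_(E `&` U @^-1` C) w)%:E)%E.
  have mk : measurable_fun setT (fun h : measurableTypeR R =>
      (expR (h * U w - h ^+ 2 / 2) * normal_pdf 0 1 (U w))%:E).
    have mq : measurable_fun setT (fun h : R => h * U w - h ^+ 2 / 2).
      by apply: measurable_funB => //; apply: measurable_funM.
    apply/measurable_EFinP/measurable_funM => //.
    exact: (measurableT_comp (@measurable_expR R) mq).
  rewrite -[RHS]mule1 -(integral_expR_tilt (U w)) -ge0_integralZl//; last first.
    by move=> h _; rewrite lee_fin mulr_ge0 ?expR_ge0 ?normal_pdf_ge0.
  apply: eq_integral => h _; rewrite /H/= /f -!EFinM; congr EFin.
  rewrite !indicE.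
  have -> : (w \in E `&` U @^-1` C) = (w \in E) && (U w \in C).
    apply/idP/idP => [|/andP[]]; first by rewrite inE => -[/= ? ?]; rewrite !mem_set.
    by rewrite !inE.
  by case: (w \in E); case: (U w \in C); rewrite /=; ring.
under eq_integral do rewrite innerF.
under [RHS]eq_integral do rewrite innerH.
have mUC : measurable (U @^-1` C) by rewrite -[X in measurable X]setTI; exact: mU.
rewrite ge0_integralZl//; last exact/measurable_EFinP.
rewrite !integral_indic ?setIT//; last exact: measurableI.
by move=> <-; rewrite muleC.
Qed.

(** * Random supports and neighbourhoods in a sparse graph *)

Section random_support.
Context (R : realType) (I : finType) (e : R).

(** The law of a random subset of [I] that contains every point independently
    with probability [e]. *)
Definition support_weight (S : {set I}) : R :=
  \prod_(i : I) (if i \in S then e else 1 - e).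
Local Notation wt := support_weight.

(** Expanding the product over subsets; the moments of the random support below
    are special cases. *)
Lemma sum_weight_prod (a b : I -> R) :
  \sum_(S : {set I}) wt S * \prod_i (if i \in S then a i else b i) =
  \prod_i (e * a i + (1 - e) * b i).
Proof.
rewrite (bigA_distr _ _ (fun i => e * a i) (fun i => (1 - e) * b i)).
apply: eq_big => [S|S _]; first by rewrite inE.
by rewrite -big_split; apply: eq_bigr => i _; case: ifP.
Qed.

Lemma sum_weight : \sum_(S : {set I}) wt S = 1.
Proof.
transitivity (\sum_(S : {set I}) wt S * \prod_i (if i \in S then 1 else 1)).
  by apply: eq_bigr => S _; rewrite big1 ?mulr1// => i _; case: ifP.
rewrite (sum_weight_prod (fun=> 1) (fun=> 1)) big1// => i _.
by rewrite !mulr1 addrC subrK.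
Qed.

Lemma sum_weight_sub (A : {set I}) :
  \sum_(S : {set I}) wt S * (A \subset S)%:R = e ^+ #|A|.
Proof.
transitivity (\sum_(S : {set I}) wt S *
    \prod_i (if i \in S then 1 else (i \notin A)%:R)).
  apply: eq_bigr => S _; congr (_ * _).
  have [AS|/fintype.subsetPn[i iA iS]] := boolP (A \subset S).
    rewrite [RHS]big1// => i _; case: ifPn => // iS.
    by rewrite (contra (fintype.subsetP AS i)).
  by rewrite [RHS](bigD1 i)//= (negbTE iS) iA mul0r.
rewrite (sum_weight_prod (fun=> 1) (fun i => (i \notin A)%:R)).
rewrite (bigID (mem A))/= [X in _ * X = _]big1 => [|i ->]; last first.
  by rewrite !mulr1 addrC subrK.
rewrite mulr1 -prodr_const; apply: eq_bigr => i ->.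
by rewrite mulr1 mulr0 addr0.
Qed.

Lemma sum_weight_mem i : \sum_(S : {set I}) wt S * (i \in S)%:R = e.
Proof.
rewrite -[RHS]expr1 -(cards1 i) -sum_weight_sub.
by apply: eq_bigr => S _; rewrite finset.sub1set.
Qed.

Lemma sum_weight_mem2 i j : i != j ->
  \sum_(S : {set I}) wt S * ((i \in S) && (j \in S))%:R = e ^+ 2.
Proof.
have c2 : #|[set i; j]%SET| = (i != j).+1 by exact: cards2.
move=> ij; move: c2; rewrite ij => <-; rewrite -sum_weight_sub.
by apply: eq_bigr => S _; rewrite finset.subUset !finset.sub1set.
Qed.

(** Exchanging the parts outside [A] of two independent copies of the support
    preserves their joint law, and turns [f S * g S'] into [f S * g S]. *)
Lemma sum_weight_indep (A : {set I}) (f g : {set I} -> R) :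
  (forall S, f S = f (S :&: A)) -> (forall S, g S = g (S :\: A)) ->
  \sum_(S : {set I}) wt S * (f S * g S) =
  (\sum_(S : {set I}) wt S * f S) * (\sum_(S : {set I}) wt S * g S).
Proof.
move=> fA gA.
pose swap (SS : {set I} * {set I}) : {set I} * {set I} :=
  ((SS.1 :&: A) :|: (SS.2 :\: A), (SS.2 :&: A) :|: (SS.1 :\: A)).
have swapK : involutive swap.
  move=> [S S']; congr (_, _); apply/setP => i; rewrite !inE;
  by case: (i \in A); case: (i \in S); case: (i \in S').
rewrite big_distrlr/= pair_big/= (reindex_inj (inv_inj swapK))/=.
transitivity (\sum_(SS : {set I} * {set I})
    (wt SS.1 * (f SS.1 * g SS.1)) * wt SS.2).
  rewrite -(pair_bigA _ (fun S S' => (wt S * (f S * g S)) * wt S'))/=.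
  by apply: eq_bigr => S _; rewrite -mulr_sumr sum_weight mulr1.
apply: eq_bigr => -[S S'] _ /=.
have -> : f (S :&: A :|: S' :\: A) = f S.
  rewrite fA [RHS]fA; congr f; apply/setP => i; rewrite !inE.
  by case: (i \in A); rewrite ?andbF ?andbT ?orbF.
have -> : g (S' :&: A :|: S :\: A) = g S.
  rewrite gA [RHS]gA; congr g; apply/setP => i; rewrite !inE.
  by case: (i \in A); rewrite ?andbF ?andbT ?orbF.
have wtE : wt (S :&: A :|: S' :\: A) * wt (S' :&: A :|: S :\: A) = wt S * wt S'.
  rewrite /wt -!big_split; apply: eq_bigr => i _; rewrite !inE /=.
  case: (i \in A); case: (i \in S); case: (i \in S') => //=; exact: mulrC.
by rewrite mulrACA wtE; ring.
Qed.

Hypothesis e01 : 0 <= e <= 1.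

Lemma weight_ge0 S : 0 <= wt S.
Proof.
have /andP[e0 e1] := e01.
by apply: prodr_ge0 => i _; case: ifP => // _; rewrite subr_ge0.
Qed.

Section neighbours.
Context (E : rel I) (D : nat).
Hypothesis Esym : symmetric E.
Hypothesis Erefl : reflexive E.
Hypothesis degE : forall i, (#|[pred j | E i j]| <= D)%N.

Definition common_neighbour : rel I := fun i j => [exists k, E i k && E j k].

Definition scattered (S : {set I}) : bool :=
  [forall i in S, forall j in S, common_neighbour i j ==> (i == j)].

Lemma scatteredP S i j : scattered S -> i \in S -> j \in S ->
  common_neighbour i j -> i = j.
Proof.
move=> /forall_inP sS iS jS ij.
by have /forall_inP/(_ _ jS) := sS _ iS; rewrite ij => /eqP.
Qed.

Lemma common_neighbour_edge i j : E i j -> common_neighbour i j.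
Proof. by move=> Eij; apply/existsP; exists j; rewrite Eij Erefl. Qed.

(** A common neighbour is reached by two steps in the graph. *)
Lemma card_common_neighbour i :
  (#|[pred j | common_neighbour i j]| <= D ^ 2)%N.
Proof.
apply: (@leq_trans (\sum_(k | E i k) #|[pred j | E k j]|)); last first.
  rewrite expnS expn1; apply: (@leq_trans (\sum_(k | E i k) D)).
    by apply: leq_sum => k _.
  by rewrite sum_nat_const leq_mul2r degE orbT.
rewrite -sum1_card.
under [leqRHS]eq_bigr do rewrite -sum1_card big_mkcond.
rewrite exchange_big/= [leqLHS]big_mkcond; apply: leq_sum => j _.
rewrite inE; case: ifP => // /existsP[k /andP[ik jk]].
by rewrite (bigD1 k)//= inE Esym jk.
Qed.

(** Union bound over the pairs of points with a common neighbour. *)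
Lemma sum_weight_not_scattered :
  \sum_(S : {set I}) wt S * (~~ scattered S)%:R <= #|I|%:R * D%:R ^+ 2 * e ^+ 2.
Proof.
have /andP[e0 e1] := e01.
pose pairs i j := (i != j) && common_neighbour i j.
apply: (@le_trans _ _ (\sum_(S : {set I}) wt S *
    \sum_i \sum_(j | pairs i j) ((i \in S) && (j \in S))%:R)).
  apply: ler_sum => S _; apply: ler_wpM2l; first exact: weight_ge0.
  have [_|nsep] := boolP (scattered S).
    by apply: sumr_ge0 => i _; apply: sumr_ge0.
  move: nsep; rewrite /scattered negb_forall_in => /exists_inP[i iS].
  rewrite negb_forall_in => /exists_inP[j jS]; rewrite negb_imply => /andP[cij ij].
  rewrite (bigD1 i)//= (bigD1 j) /pairs ?ij//= iS jS /= -addrA lerDl.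
  by rewrite addr_ge0// ?sumr_ge0// => k _; rewrite sumr_ge0.
under eq_bigr do rewrite mulr_sumr.
rewrite exchange_big/= -mulrA -sum1_card natr_sum mulr_suml.
apply: ler_sum => i _; rewrite mul1r.
under eq_bigr do rewrite mulr_sumr.
rewrite exchange_big/=.
apply: (@le_trans _ _ (\sum_(j | pairs i j) e ^+ 2)).
  apply: ler_sum => j /andP[ij _]; by rewrite sum_weight_mem2.
rewrite sumr_const -[leLHS]mulr_natl; apply: ler_wpM2r; first exact: sqr_ge0.
rewrite -natrX ler_nat; apply: leq_trans (card_common_neighbour i).
by apply: subset_leq_card; apply/fintype.subsetP => j; rewrite !inE => /andP[].
Qed.

Definition edges_between (S S' : {set I}) : nat :=
  (\sum_(i in S) \sum_(j in S') E i j)%N.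

(** Two neighbours of [i] in [S'] would have [i] as a common neighbour. *)
Lemma edges_from_le1 i S' : scattered S' -> (\sum_(j in S') E i j <= 1)%N.
Proof.
move=> sS'; have [j /andP[jS' ij]|none] := pickP [pred j | (j \in S') && E i j].
  rewrite (bigD1 j)//= ij big1 ?addn0// => k /andP[kS' kj].
  apply/eqP; rewrite eqb0; apply: contra kj => ik; apply/eqP.
  apply: (scatteredP sS') => //; apply/existsP; exists i.
  by rewrite !(Esym _ i) ik ij.
by rewrite big1// => j jS'; have := none j; rewrite /= jS' /= => ->.
Qed.

(** Conditionally on one support, each coordinate of the other one contributes
    a factor [M] with probability at most [e] times its number of neighbours. *)
Lemma sum_weight_edges (M : R) : 0 <= M ->
  \sum_(S : {set I} | scattered S) \sum_(S' : {set I} | scattered S')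
     wt S * wt S' * M ^+ edges_between S S' <=
  expR (#|I|%:R * (e * (expR (e * M * D%:R) - 1))).
Proof.
have /andP[e0 e1] := e01; move=> M0.
rewrite exchange_big/=.
pose x := expR (e * M * D%:R).
apply: (@le_trans _ _ (\sum_(S' : {set I}) wt S' * x ^+ #|S'|)).
  rewrite [leRHS](bigID scattered)/= ler_wpDr//.
    by apply: sumr_ge0 => S' _; rewrite mulr_ge0 ?weight_ge0// exprn_ge0// expR_ge0.
  apply: ler_sum => S' sS'.
  under eq_bigr do rewrite mulrAC mulrC.
  rewrite -mulr_sumr; apply: ler_wpM2l; first exact: weight_ge0.
  (* [k i] is 0 or 1, hence [M ^+ k i <= 1 + M * k i], which is linear in [k i]. *)
  pose k i : R := (\sum_(j in S') E i j)%N%:R.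
  apply: (@le_trans _ _ (\sum_(S : {set I}) wt S *
      \prod_i (if i \in S then 1 + M * k i else 1))).
    have prod_ge0 S : 0 <= \prod_i (if i \in S then 1 + M * k i else 1).
      by apply: prodr_ge0 => i _; case: ifP => // _; rewrite addr_ge0// mulr_ge0.
    rewrite [leRHS](bigID scattered)/= ler_wpDr//.
      by apply: sumr_ge0 => S _; rewrite mulr_ge0 ?weight_ge0.
    apply: ler_sum => S sS; apply: ler_wpM2l; first exact: weight_ge0.
    rewrite /edges_between -prodrXr big_mkcond/=; apply: ler_prod => i _.
    case: ifP => [_|_]; last by rewrite ler01 lexx.
    rewrite exprn_ge0//= /k.
    have := edges_from_le1 i sS'; case: (\sum_(j in S') E i j)%N => [|[|//]] _.
      by rewrite expr0 mulr0 addr0.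
    by rewrite expr1 mulr1 lerDr.
  rewrite sum_weight_prod.
  apply: (@le_trans _ _ (\prod_i expR (e * M * k i))).
    apply: ler_prod => i _; rewrite (_ : e * _ + _ = 1 + e * M * k i); last ring.
    by rewrite expR_ge1Dx andbT addr_ge0// !mulr_ge0.
  rewrite -expR_sum -mulr_sumr -expRM_natr ler_expR -[leRHS]mulrA ler_wpM2l ?mulr_ge0//.
  rewrite -natr_sum -natrM ler_nat exchange_big/= mulnC -sum_nat_const.
  apply: leq_sum => j _; rewrite -big_mkcond/= sum1_card.
  apply: leq_trans (degE j); apply: subset_leq_card.
  by apply/fintype.subsetP => i; rewrite !inE Esym.
under eq_bigr do rewrite -prodr_const big_mkcond/=.
rewrite (sum_weight_prod (fun=> x) (fun=> 1)) prodr_const [X in _ ^+ X](_ : _ = #|I|)//.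
rewrite -/x [X in expR X]mulrC expRM_natr; apply: lerXn2r.
- by rewrite nnegrE addr_ge0// ?mulr_ge0 ?expR_ge0// subr_ge0.
- by rewrite nnegrE expR_ge0.
rewrite (_ : e * x + _ = 1 + e * (x - 1)); last ring.
exact: expR_ge1Dx.
Qed.

End neighbours.
End random_support.

Section random_support_neighbours.
Context (R : realType) (I : finType) (e : R).
Hypothesis e01 : 0 <= e <= 1.
Local Notation wt := (support_weight e).
Implicit Types (S A : {set I}).

Lemma sum_weight_avoid A :
  1 - #|A|%:R * e <= \sum_(S : {set I}) wt S * (S :&: A == finset.set0)%:R.
Proof.
have union : (\sum_(S : {set I}) wt S * (\sum_(j in A) (j \in S)%:R)) = #|A|%:R * e.
  under eq_bigr do rewrite mulr_sumr.
  rewrite exchange_big/= (eq_bigr (fun=> e)) => [|j _]; last exact: sum_weight_mem.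
  by rewrite sumr_const mulr_natl.
rewrite lerBlDr -union -big_split -[leLHS](sum_weight I e) /=.
apply: ler_sum => S _; rewrite -mulrDr -[leLHS]mulr1.
apply: ler_wpM2l; first exact: weight_ge0.
have [_|/set0Pn[j]] := eqVneq (S :&: A) finset.set0.
  by rewrite lerDl sumr_ge0.
rewrite inE => /andP[jS jA]; rewrite add0r (bigD1 j)//= jS lerDl.
by rewrite sumr_ge0.
Qed.

Lemma sum_weight_alone i A : i \in A ->
  e - #|A|%:R * e ^+ 2 <= \sum_(S : {set I}) wt S * (S :&: A == [set i]%SET)%:R.
Proof.
move=> iA.
have e2 : 0 <= e ^+ 2 by exact: sqr_ge0.
have union : \sum_(S : {set I}) wt S *
    (\sum_(j in A | j != i) ((i \in S) && (j \in S))%:R) <= #|A|%:R * e ^+ 2.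
  under eq_bigr do rewrite mulr_sumr.
  rewrite exchange_big/= (eq_bigr (fun=> e ^+ 2)).
    rewrite [leLHS]sumr_const -[leLHS]mulr_natl ler_wpM2r// ler_nat.
    by apply: subset_leq_card; apply/fintype.subsetP => j; rewrite unfold_in => /andP[].
  by move=> j /andP[_ ji]; rewrite sum_weight_mem2// eq_sym.
rewrite lerBlDr; apply: le_trans (lerD (lexx _) union).
rewrite -big_split -[leLHS](sum_weight_mem e i) /=.
apply: ler_sum => S _; rewrite -mulrDr.
apply: ler_wpM2l; first exact: weight_ge0.
have [iS|_] := boolP (i \in S); last by rewrite addr_ge0// sumr_ge0.
have [_|ne] := eqVneq (S :&: A) [set i]%SET; first by rewrite lerDl sumr_ge0.
have [j] : exists j, j \in (S :&: A) :\ i.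
  apply/set0Pn; apply: contraNneq ne => /eqP; rewrite finset.setD_eq0 => sub.
  by rewrite finset.eqEsubset sub finset.sub1set inE iS iA.
rewrite !inE => /and3P[ji jS jA]; rewrite add0r (bigD1 j) ?jA//= jS lerDl.
by rewrite sumr_ge0.
Qed.

End random_support_neighbours.

Lemma support_weight0 (R : realType) (I : finType) (S : {set I}) :
  support_weight (0 : R) S = (S == finset.set0)%:R.
Proof.
rewrite /support_weight subr0; have [->|/set0Pn[i iS]] := eqVneq S finset.set0.
  by rewrite big1// => i _; rewrite inE.
by rewrite (bigD1 i)//= iS mul0r.
Qed.

(** * Linear functionals of the noise *)

Section real_integrals.
Context (R : realType) (d : measure_display) (T : measurableType d)
  (mu : {measure set T -> \bar R}).

Lemma ge0_integral_EFin_sum (I : finType) (Q : pred I) (c : I -> R)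
    (f : I -> T -> R) :
  (forall i, measurable_fun setT (f i)) -> (forall i w, 0 <= f i w) ->
  (forall i, 0 <= c i) ->
  (\int[mu]_w (\sum_(i | Q i) c i * f i w)%:E =
   \sum_(i | Q i) (c i)%:E * \int[mu]_w (f i w)%:E)%E.
Proof.
move=> mf f0 c0.
under eq_integral do rewrite -big_filter -sumEFin.
rewrite ge0_integral_sum//; last 2 first.
- by move=> i; apply/measurable_EFinP; exact: measurable_funM.
- by move=> i w _; rewrite lee_fin mulr_ge0.
rewrite big_filter; apply: eq_bigr => i _.
under eq_integral do rewrite EFinM.
rewrite ge0_integralZl_EFin//; last exact/measurable_EFinP.
by move=> w _; rewrite lee_fin.
Qed.

Lemma ge0_le_integral_EFin (f g : T -> R) :
  (forall w, 0 <= f w) -> measurable_fun setT f -> measurable_fun setT g ->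
  (forall w, f w <= g w) -> (\int[mu]_w (f w)%:E <= \int[mu]_w (g w)%:E)%E.
Proof.
move=> f0 mf mg fg; apply: ge0_le_integral => //.
- by move=> w _; rewrite lee_fin.
- exact/measurable_EFinP.
- exact/measurable_EFinP.
- by move=> w _; rewrite lee_fin.
Qed.

Lemma ge0_integral_EFinD (f g : T -> R) :
  (forall w, 0 <= f w) -> measurable_fun setT f ->
  (forall w, 0 <= g w) -> measurable_fun setT g ->
  (\int[mu]_w (f w + g w)%:E =
   \int[mu]_w (f w)%:E + \int[mu]_w (g w)%:E)%E.
Proof.
move=> f0 mf g0 mg; rewrite -ge0_integralD//.
- by move=> w _; rewrite lee_fin.
- exact/measurable_EFinP.
- by move=> w _; rewrite lee_fin.
- exact/measurable_EFinP.
Qed.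

Lemma ge0_integral_EFinZ (k : R) (f : T -> R) : 0 <= k ->
  (forall w, 0 <= f w) -> measurable_fun setT f ->
  (\int[mu]_w (k * f w)%:E = k%:E * \int[mu]_w (f w)%:E)%E.
Proof.
move=> k0 f0 mf; under eq_integral do rewrite EFinM.
rewrite ge0_integralZl_EFin//; last exact/measurable_EFinP.
by move=> w _; rewrite lee_fin.
Qed.

End real_integrals.

Lemma integral_prob_cst (R : realType) (d : measure_display)
    (T : measurableType d) (P : probability T R) (k : R) :
  (\int[P]_w k%:E = k%:E)%E.
Proof.
have PT : P setT = 1%E := probability_setT P.
by rewrite integral_cst//= PT mule1.
Qed.

Lemma integral_prob_le1 (R : realType) (d : measure_display)
    (T : measurableType d) (P : probability T R) (f : T -> R) :
  measurable_fun setT f -> (forall w, 0 <= f w <= 1) ->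
  (\int[P]_w (f w)%:E <= 1)%E.
Proof.
move=> mf f01; rewrite -(integral_prob_cst P 1).
by apply: ge0_le_integral_EFin => // w; have /andP[] := f01 w.
Qed.

Section coordinates.
Context (R : realType) (d : measure_display) (T : measurableType d)
  (P : probability T R) (p : nat) (z : {RV P >-> p.-tuple R})
  (Omega : 'M[R]_p).
Hypothesis shift_z : gaussian_shift z Omega.
Hypothesis Omega_sym : forall i j, Omega i j = Omega j i.
Hypothesis Omega_diag : forall i, Omega i i = 1.
Implicit Types (c : 'I_p -> R) (S : {set 'I_p}).

(** The coordinates of [Omega z], a centred Gaussian vector whose covariance
    matrix is [Omega] itself. *)
Definition innovation (i : 'I_p) (w : T) : R := tnth (mulmxt Omega (z w)) i.

Local Notation X := innovation.

Definition bilin c c' : R := \sum_i \sum_j c i * Omega i j * c' j.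

Lemma measurable_innovation i : measurable_fun setT (X i).
Proof.
apply: (measurableT_comp (measurable_tnth i)).
apply: (measurableT_comp (measurable_mulmxt Omega)); exact: measurable_funPT.
Qed.

Lemma measurable_linear c : measurable_fun setT (fun w => \sum_i c i * X i w).
Proof.
apply: measurable_sum => i; apply: measurable_funM => //.
exact: measurable_innovation.
Qed.

Lemma measurable_exp_linear c (b : R) :
  measurable_fun setT (fun w => expR (\sum_i c i * X i w + b)).
Proof.
apply: measurableT_comp => //; apply: measurable_funD => //.
exact: measurable_linear.
Qed.

Lemma bilin_tuple c c' :
  \sum_(i < p) tnth [tuple c i | i < p] i *
    tnth (mulmxt Omega [tuple c' i | i < p]) i = bilin c c'.
Proof.
apply: eq_bigr => i _; rewrite !tnth_mktuple mulr_sumr.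
by apply: eq_bigr => j _; rewrite tnth_mktuple mulrA.
Qed.

(** The Cameron--Martin formula applied to a constant function. *)
Lemma innovation_mgf c (b : R) :
  (\int[P]_w (expR (\sum_i c i * X i w + b))%:E =
   (expR (bilin c c / 2 + b))%:E)%E.
Proof.
have mw : measurable_fun setT (fun w => (expR (\sum_i c i * X i w + b))%:E : \bar R).
  by apply/measurable_EFinP; exact: measurable_exp_linear.
pose a := [tuple c i | i < p].
have i1 : (\int[P]_w (cst 1 (addt a (z w))) = 1)%E.
  exact: (integral_prob_cst P 1).
rewrite -[RHS]mule1 -i1.
rewrite (@shift_z _ (cst 1%E))// bilin_tuple.
have mshift : measurable_fun setT (fun w => (expR (\sum_i tnth [tuple c i | i < p] i *
    tnth (mulmxt Omega (z w)) i - bilin c c / 2))%:E : \bar R).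
  apply/measurable_EFinP.
  rewrite (_ : (fun w => _) = (fun w => expR (\sum_i c i * X i w + - (bilin c c / 2)))).
    exact: measurable_exp_linear.
  by apply/funext => w; under eq_bigr do rewrite tnth_mktuple.
under [in RHS]eq_integral do rewrite mul1e.
rewrite -ge0_integralZl//.
apply: eq_integral => w _; rewrite -EFinM -expRD; congr (expR _)%:E.
under [in RHS]eq_bigr do rewrite tnth_mktuple.
rewrite /X; ring.
Qed.

Lemma bilinC c c' : bilin c c' = bilin c' c.
Proof.
rewrite /bilin exchange_big/=; apply: eq_bigr => i _; apply: eq_bigr => j _.
by rewrite Omega_sym; ring.
Qed.

Lemma bilinDD c c' :
  bilin (c \+ c') (c \+ c') = bilin c c + bilin c' c' + bilin c c' *+ 2.
Proof.
rewrite mulr2n {2}[bilin c c']bilinC /bilin -!big_split; apply: eq_bigr => i _.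
by rewrite -!big_split; apply: eq_bigr => j _ /=; ring.
Qed.

Definition edge : rel 'I_p := fun i j => Omega i j != 0.

Lemma edge_sym : symmetric edge.
Proof. by move=> i j; rewrite /edge Omega_sym. Qed.

Lemma edge_refl : reflexive edge.
Proof. by move=> i; rewrite /edge Omega_diag oner_neq0. Qed.

(** Scattered coordinates of [Omega z] are uncorrelated. *)
Lemma bilin_scattered S c : scattered edge S -> (forall i, i \notin S -> c i = 0) ->
  bilin c c = \sum_(i in S) c i ^+ 2.
Proof.
move=> sS c0; rewrite [RHS]big_mkcond; apply: eq_bigr => i _.
have [iS|/c0 ->] := ifPn; last by rewrite big1// => j _; rewrite !mul0r.
rewrite (bigD1 i)//= Omega_diag mulr1 -expr2 big1 ?addr0// => j ji.
have [jS|/c0 ->] := boolP (j \in S); last by rewrite mulr0.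
suff -> : Omega i j = 0 by rewrite mulr0 mul0r.
apply: contraNeq ji => ij; apply/eqP/esym/(scatteredP sS iS jS).
exact: (common_neighbour_edge edge_refl).
Qed.

End coordinates.

(** * The truncated likelihood ratio *)

Section truncated_likelihood_ratio.
Context (R : realType) (d : measure_display) (T : measurableType d)
  (P : probability T R) (p : nat) (z : {RV P >-> p.-tuple R})
  (Omega : 'M[R]_p) (tau t : R).
Hypothesis shift_z : gaussian_shift z Omega.
Hypothesis Omega_diag : forall i, Omega i i = 1.
Hypothesis tau_t : tau <= t.
Implicit Types (S : {set 'I_p}).

Local Notation X := (innovation z Omega).
Local Notation scattered := (scattered (edge Omega)).

Definition spike S : p.-tuple R := [tuple if i \in S then tau else 0 | i < p].

(** For scattered [S] this is the likelihood ratio of the signal [spike S] against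
    the null, because the quadratic form of [Omega] at [spike S] is then
    [tau ^+ 2 *+ #|S|]. *)
Definition spike_lr S (w : T) : R :=
  expR (\sum_i (if i \in S then tau else 0) * X i w + - (tau ^+ 2 / 2 *+ #|S|)).

Definition all_below S : set T := [set w | forall i, i \in S -> X i w <= t].

Definition trunc_lr S (w : T) : R := spike_lr S w * \1_(all_below S) w.

Lemma measurable_spike_lr S : measurable_fun setT (spike_lr S).
Proof. exact: measurable_exp_linear. Qed.

Lemma measurable_all_below S : measurable (all_below S).
Proof.
rewrite (_ : all_below S = \bigcap_(i in [set i | i \in S]) (X i @^-1` `]-oo, t])).
  apply: fin_bigcap_measurable => [|i _]; first exact: finite_finset.
  by rewrite -[X in measurable X]setTI; apply: measurable_innovation.
apply/seteqP; split => w /= H i iS; first by rewrite /= in_itv /= H.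
by have := H i iS; rewrite /= in_itv.
Qed.

Lemma measurable_trunc_lr S : measurable_fun setT (trunc_lr S).
Proof.
apply: measurable_funM; first exact: measurable_spike_lr.
exact/measurable_indic/measurable_all_below.
Qed.

Lemma spike_lr_ge0 S w : 0 <= spike_lr S w.
Proof. exact: expR_ge0. Qed.

Lemma trunc_lr_ge0 S w : 0 <= trunc_lr S w.
Proof. by rewrite mulr_ge0// spike_lr_ge0. Qed.

Lemma bilin_spike S : scattered S ->
  bilin Omega (fun i => if i \in S then tau else 0)
    (fun i => if i \in S then tau else 0) = tau ^+ 2 *+ #|S|.
Proof.
move=> sS; rewrite (bilin_scattered Omega_diag sS).
  by rewrite -sumr_const; apply: eq_bigr => i ->.
by move=> i /negbTE ->.
Qed.

Lemma shift_spike S (psi : p.-tuple R -> \bar R) : scattered S ->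
  measurable_fun setT psi -> (forall x, 0 <= psi x)%E ->
  (\int[P]_w psi (addt (spike S) (z w)) =
   \int[P]_w (psi (z w) * (spike_lr S w)%:E))%E.
Proof.
move=> sS mpsi psi0; rewrite (@shift_z (spike S) psi mpsi psi0).
apply: eq_integral => w _.
congr (_ * (expR _)%:E)%E; rewrite /spike bilin_tuple bilin_spike// mulrnAl.
by congr (_ + _); apply: eq_bigr => i _; rewrite tnth_mktuple.
Qed.

(** Under the tilted law a coordinate in [S] is [N(tau, 1)], so Chernoff's bound
    controls the probability that it exceeds [t]. *)
Lemma trunc_lr_mass S : scattered S ->
  ((1 - expR (- ((t - tau) ^+ 2 / 2)) *+ #|S|)%:E <=
   \int[P]_w (trunc_lr S w)%:E)%E.
Proof.
move=> sS; pose u := t - tau.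
have u0 : 0 <= u by rewrite subr_ge0.
pose c i j : R := if j \in S then tau + (if j == i then u else 0) else 0.
(* The exponential majorant of the ratio on the event that coordinate [i] of [S]
   exceeds [t]. *)
pose over i w := expR (\sum_j c i j * X j w + - (tau ^+ 2 / 2 *+ #|S| + u * t)).
have mover i : measurable_fun setT (over i) by exact: measurable_exp_linear.
have int_over i : i \in S ->
    (\int[P]_w (over i w)%:E = (expR (- (u ^+ 2 / 2)))%:E)%E.
  move=> iS; rewrite innovation_mgf//; congr (expR _)%:E.
  rewrite (bilin_scattered Omega_diag sS); last first.
    by move=> j /negbTE jS; rewrite /c jS.
  rewrite (bigD1 i)//= /c iS eqxx.
  rewrite (eq_bigr (fun=> tau ^+ 2)); last first.
    by move=> j /andP[-> /negbTE ->]; rewrite addr0.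
  have -> : tau ^+ 2 / 2 *+ #|S| = (\sum_(j in S) tau ^+ 2) / 2.
    by rewrite sumr_const mulrnAl.
  by rewrite [X in _ + - (X / 2 + _)](bigD1 i)//= /u; field.
have int_lr : (\int[P]_w (spike_lr S w)%:E = 1)%E.
  rewrite innovation_mgf// bilin_spike// mulrnAl.
  by rewrite subrr expR0.
rewrite EFinB leeBlDr// -int_lr.
have -> : (expR (- ((t - tau) ^+ 2 / 2)) *+ #|S|)%:E =
    (\sum_(i in S) \int[P]_w (over i w)%:E)%E.
  rewrite (eq_bigr _ int_over) sumEFin; congr EFin.
  by rewrite sumr_const.
have mt := measurable_trunc_lr S.
have mso : measurable_fun setT (fun w => \sum_(i in S) over i w).
  by under eq_fun do rewrite -big_filter; exact: measurable_sum.
have over0 i w : 0 <= over i w by exact: expR_ge0.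
have -> : (\sum_(i in S) \int[P]_w (over i w)%:E =
    \int[P]_w (\sum_(i in S) over i w)%:E)%E.
  have := ge0_integral_EFin_sum P (mem S) mover over0 (fun=> ler01).
  under eq_integral do under eq_bigr do rewrite mul1r.
  by move=> ->; under [RHS]eq_bigr do rewrite mul1e.
rewrite -ge0_integral_EFinD//; last 2 first.
- exact: trunc_lr_ge0.
- by move=> w; rewrite sumr_ge0.
apply: ge0_le_integral_EFin => //.
- exact: spike_lr_ge0.
- exact: measurable_spike_lr.
- exact: measurable_funD.
move=> w; rewrite /trunc_lr indicE.
have [_|] := boolP (w \in all_below S).
  by rewrite mulr1 lerDl sumr_ge0.
rewrite notin_setE /all_below /= => /existsNP[i /not_implyP[iS /negP]].
rewrite -ltNge => tX; rewrite mulr0 add0r (bigD1 i)//=.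
apply: (@le_trans _ _ (over i w)); last by rewrite lerDl sumr_ge0.
rewrite ler_expR -subr_ge0.
have -> : \sum_j c i j * X j w =
    \sum_j (if j \in S then tau else 0) * X j w + u * X i w.
  rewrite (bigD1 i)//= [X in _ = X + _](bigD1 i)//= /c iS eqxx.
  rewrite (eq_bigr (fun j => (if j \in S then tau else 0) * X j w)); first ring.
  by move=> j /negbTE ->; rewrite addr0.
rewrite (_ : _ - _ = u * (X i w - t)); last ring.
by rewrite mulr_ge0// subr_ge0 ltW.
Qed.

End truncated_likelihood_ratio.

Section second_moment.
Context (R : realType) (d : measure_display) (T : measurableType d)
  (P : probability T R) (p : nat) (z : {RV P >-> p.-tuple R})
  (Omega : 'M[R]_p) (tau t s : R).
Hypothesis shift_z : gaussian_shift z Omega.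
Hypothesis Omega_sym : forall i j, Omega i j = Omega j i.
Hypothesis Omega_diag : forall i, Omega i i = 1.
Hypothesis Omega_le1 : forall i j, Omega i j <= 1.
Hypothesis s0 : 0 <= s.
Implicit Types (S : {set 'I_p}).

Local Notation X := (innovation z Omega).
Local Notation scattered := (scattered (edge Omega)).

Local Notation trunc_lr := (trunc_lr z Omega tau t).
Local Notation all_below := (all_below z Omega t).

(** Chernoff's bound, with free parameter [s], on the logarithm of the second
    moment of the ratio [expR (tau * x - tau ^+ 2 / 2)] truncated at [x <= t]. *)
Definition log_moment : R := 2 * (tau - s / 2) ^+ 2 - tau ^+ 2 + s * t.

(** The edges between two scattered supports form a matching, so the product of
    the two ratios splits over matched pairs and single coordinates. Truncation
    is used on the matched coordinates, where the indicator of [x <= t] is at most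
    [expR (s / 2 * (t - x))]; the single ones integrate to one. The correlation
    of a matched pair is at most one, as if the two coordinates were equal. *)
Lemma trunc_lr_pair S S' : scattered S -> scattered S' ->
  (\int[P]_w (trunc_lr S w * trunc_lr S' w)%:E <=
   (expR log_moment ^+ edges_between (edge Omega) S S')%:E)%E.
Proof.
move=> sS sS'.
pose E i j : R := (edge Omega i j)%:R.
pose K : R := (edges_between (edge Omega) S S')%:R.
(* [m A i] is 1 if [i] is matched to a point of [A] and 0 otherwise. *)
pose m (A : {set 'I_p}) i : R := (\sum_(j in A) edge Omega i j)%N%:R.
have m01 (A : {set 'I_p}) i : scattered A -> (m A i = 0) \/ (m A i = 1).
  move=> sA; have := edges_from_le1 (edge_sym Omega_sym) i sA; rewrite /m.
  by case: (\sum_(j in A) _)%N => [|[|//]] _; [left|right].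
have KE : K = \sum_(i in S) m S' i by rewrite /K /edges_between natr_sum.
have KE' : K = \sum_(j in S') m S j.
  rewrite /K /edges_between exchange_big natr_sum; apply: eq_bigr => j _.
  by congr (_%:R); apply: eq_bigr => i _; rewrite edge_sym.
have KEE : K = \sum_(i in S) \sum_(j in S') E i j.
  by rewrite /K /edges_between natr_sum; apply: eq_bigr => i _; rewrite natr_sum.
pose v A i : R := tau - s / 2 * m A i.
pose c (A B : {set 'I_p}) i : R := if i \in A then v B i else 0.
pose b := s * t * K - (tau ^+ 2 / 2 *+ #|S| + tau ^+ 2 / 2 *+ #|S'|).
pose major w := expR (\sum_i (c S S' \+ c S' S) i * X i w + b).
have mmajor : measurable_fun setT major by exact: measurable_exp_linear.
have mt := measurable_trunc_lr.
apply: (@le_trans _ _ (\int[P]_w (major w)%:E)%E).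
  apply: ge0_le_integral_EFin => //.
  - by move=> w; rewrite mulr_ge0// trunc_lr_ge0.
  - exact: measurable_funM.
  move=> w; rewrite /trunc_lr !indicE.
  have [|_] := boolP (w \in all_below S); last by rewrite mulr0 mul0r expR_ge0.
  have [|_] := boolP (w \in all_below S'); last by rewrite !mulr0 expR_ge0.
  rewrite !inE !mulr1 => below' below; rewrite -expRD ler_expR.
  have lin (A B : {set 'I_p}) : (forall i, i \in A -> X i w <= t) ->
      \sum_i (if i \in A then tau else 0) * X i w <=
      \sum_i c A B i * X i w + s / 2 * t * \sum_(i in A) m B i.
    move=> bA; rewrite mulr_sumr [X in _ <= _ + X]big_mkcond -big_split.
    apply: ler_sum => i _; rewrite /c /v; case: ifPn => [iA|_]; last first.
      by rewrite /= !mul0r addr0.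
    have mB0 : 0 <= m B i by exact: ler0n.
    rewrite /= -subr_ge0 (_ : _ - _ = s / 2 * m B i * (t - X i w)); last by field.
    by rewrite mulr_ge0 ?subr_ge0 ?bA// mulr_ge0// divr_ge0.
  have := lerD (lin S S' below) (lin S' S below'); rewrite -KE -KE' => H.
  rewrite addrACA; apply: (le_trans (lerD H (lexx _))).
  rewrite le_eqVlt; apply/orP; left; apply/eqP.
  have -> : \sum_i (c S S' \+ c S' S) i * X i w =
      \sum_i c S S' i * X i w + \sum_i c S' S i * X i w.
    by rewrite -big_split; apply: eq_bigr => i _; rewrite /= mulrDl.
  by rewrite /b; field.
rewrite innovation_mgf// lee_fin -expRM_natr ler_expR -/K.
rewrite bilinDD//.
have sq (A B : {set 'I_p}) : scattered A -> scattered B ->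
    bilin Omega (c A B) (c A B) =
    tau ^+ 2 *+ #|A| + (s ^+ 2 / 4 - tau * s) * \sum_(i in A) m B i.
  move=> sA sB; rewrite (bilin_scattered Omega_diag sA); last first.
    by move=> i /negbTE iA; rewrite /c iA.
  rewrite -sumr_const mulr_sumr -big_split; apply: eq_bigr => i iA.
  by rewrite /c iA /v; case: (m01 B i sB) => -> /=; field.
rewrite (sq S S')// (sq S' S)// -KE -KE'.
have cross : bilin Omega (c S S') (c S' S) <= (tau - s / 2) ^+ 2 * K.
  rewrite KEE mulr_sumr [leRHS]big_mkcond; apply: ler_sum => i _.
  rewrite /c; case: ifPn => [iS|_]; last by rewrite big1// => j _; rewrite !mul0r.
  rewrite mulr_sumr [leRHS]big_mkcond; apply: ler_sum => j _.
  case: ifPn => [jS'|_]; last by rewrite mulr0.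
  rewrite /E; have [ij|] := boolP (edge Omega i j); last first.
    by rewrite /edge negbK => /eqP ->; rewrite !mulr0 mul0r.
  have mS'i : m S' i = 1.
    have := edges_from_le1 (edge_sym Omega_sym) i sS'.
    by rewrite /m (bigD1 j)//= ij; case: (\sum_(_ < _ | _) _)%N.
  have mSj : m S j = 1.
    have := edges_from_le1 (edge_sym Omega_sym) j sS.
    by rewrite /m (bigD1 i)//= edge_sym// ij; case: (\sum_(_ < _ | _) _)%N.
  rewrite /v mS'i mSj !mulr1 mulrAC -expr2 ler_piMr ?sqr_ge0//.
rewrite /b /log_moment mulr2n.
have -> : tau ^+ 2 / 2 *+ #|S| = tau ^+ 2 *+ #|S| / 2 by rewrite mulrnAl.
have -> : tau ^+ 2 / 2 *+ #|S'| = tau ^+ 2 *+ #|S'| / 2 by rewrite mulrnAl.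
rewrite -subr_ge0 (_ : _ - _ = (tau - s / 2) ^+ 2 * K -
  bilin Omega (c S S') (c S' S)); last by field.
by rewrite subr_ge0.
Qed.

End second_moment.

Section testing_lower_bound.
Context (R : realType) (d : measure_display) (T : measurableType d)
  (P : probability T R) (p : nat) (z : {RV P >-> p.-tuple R})
  (Omega : 'M[R]_p) (D : nat) (e tau t s : R).
Hypothesis shift_z : gaussian_shift z Omega.
Hypothesis Omega_sym : forall i j, Omega i j = Omega j i.
Hypothesis Omega_diag : forall i, Omega i i = 1.
Hypothesis Omega_le1 : forall i j, Omega i j <= 1.
Hypothesis degree : forall i, (#|[pred j | edge Omega i j]| <= D)%N.
Hypothesis e01 : 0 <= e <= 1.
Hypothesis tau_t : tau <= t.
Hypothesis s0 : 0 <= s.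
Implicit Types (S : {set 'I_p}).

Local Notation X := (innovation z Omega).
Local Notation scattered := (scattered (edge Omega)).

Local Notation spike_lr := (spike_lr z Omega tau).
Local Notation trunc_lr := (trunc_lr z Omega tau t).

Local Notation wt := (support_weight e).
Local Notation log_moment := (log_moment tau t s).

Definition mixture_lr (w : T) : R :=
  \sum_(S : {set 'I_p} | scattered S) wt S * trunc_lr S w.

(** Bounds on the probability that the support is not scattered, and on the expected
    number of signal coordinates that exceed [t]. *)
Definition mass_defect : R :=
  p%:R * D%:R ^+ 2 * e ^+ 2 + p%:R * e * expR (- ((t - tau) ^+ 2 / 2)).

Definition second_moment_bound : R :=
  expR (p%:R * (e * (expR (e * expR log_moment * D%:R) - 1))).

Lemma mixture_lr_ge0 w : 0 <= mixture_lr w.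
Proof.
by apply: sumr_ge0 => S _; rewrite mulr_ge0 ?weight_ge0// trunc_lr_ge0.
Qed.

Lemma measurable_mixture_lr : measurable_fun setT mixture_lr.
Proof.
rewrite /mixture_lr; under eq_fun do rewrite -big_filter.
apply: measurable_sum => S; apply: measurable_funM => //.
exact: measurable_trunc_lr.
Qed.

Lemma mixture_lr_mass : ((1 - mass_defect)%:E <= \int[P]_w (mixture_lr w)%:E)%E.
Proof.
have mt := measurable_trunc_lr z Omega tau t.
rewrite ge0_integral_EFin_sum//; last 2 first.
- by move=> S w; exact: trunc_lr_ge0.
- by move=> S; exact: weight_ge0.
pose k := expR (- ((t - tau) ^+ 2 / 2)).
apply: (@le_trans _ _ (\sum_(S : {set 'I_p} | scattered S)
    (wt S * (1 - k *+ #|S|))%:E)%E); last first.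
  apply: lee_sum => S sS; rewrite EFinM lee_wpmul2l ?lee_fin ?weight_ge0//.
  exact: trunc_lr_mass.
rewrite sumEFin lee_fin.
have card : \sum_(S : {set 'I_p}) wt S * (k *+ #|S|) = p%:R * e * k.
  transitivity (\sum_(S : {set 'I_p}) \sum_(i < p) k * (wt S * (i \in S)%:R)).
    apply: eq_bigr => S _; rewrite -mulr_sumr -mulr_sumr -natr_sum.
    by rewrite -big_mkcond/= sum1_card -mulr_natr; ring.
  rewrite exchange_big/= (eq_bigr (fun=> k * e)).
    by rewrite sumr_const card_ord -mulr_natl; ring.
  by move=> i _; rewrite -mulr_sumr sum_weight_mem.
have nsep := sum_weight_not_scattered e01 (edge_sym Omega_sym) degree.
have split1 : \sum_(S : {set 'I_p} | scattered S) wt S * (1 - k *+ #|S|) =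
    1 - \sum_(S : {set 'I_p}) wt S * (~~ scattered S)%:R
    - \sum_(S : {set 'I_p} | scattered S) wt S * (k *+ #|S|).
  rewrite -[X in _ = X - _ - _](sum_weight 'I_p e) -sumrB [X in _ = X - _](bigID scattered)/=.
  rewrite [X in _ = _ + X - _]big1 ?addr0; last first.
by move=> S ->; rewrite /= mulr1 subrr.
  by rewrite -sumrB; apply: eq_bigr => S ->; rewrite /= mulr0 subr0 mulrBr mulr1.
have le2 : \sum_(S : {set 'I_p} | scattered S) wt S * (k *+ #|S|) <= p%:R * e * k.
  rewrite -card [leRHS](bigID scattered)/= lerDl sumr_ge0// => S _.
  by rewrite mulr_ge0 ?weight_ge0// mulrn_wge0// expR_ge0.
rewrite split1 /mass_defect -/k opprD addrA; apply: lerB => //; apply: lerB => //.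
by rewrite card_ord in nsep.
Qed.

Lemma mixture_lr_second_moment :
  (\int[P]_w (mixture_lr w ^+ 2)%:E <= second_moment_bound%:E)%E.
Proof.
have mt := measurable_trunc_lr z Omega tau t.
pose F (SS : {set 'I_p} * {set 'I_p}) w := trunc_lr SS.1 w * trunc_lr SS.2 w.
have F0 SS w : 0 <= F SS w by rewrite mulr_ge0// trunc_lr_ge0.
have mF SS : measurable_fun setT (F SS) by exact: measurable_funM.
pose sc2 (SS : {set 'I_p} * {set 'I_p}) := scattered SS.1 && scattered SS.2.
have -> : (fun w => (mixture_lr w ^+ 2)%:E) = (fun w =>
    (\sum_(SS | sc2 SS) (wt SS.1 * wt SS.2) * F SS w)%:E).
  apply/funext => w; congr EFin; rewrite expr2 /mixture_lr big_distrlr/=.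
  by rewrite pair_big/=; apply: eq_bigr => -[S S'] _; rewrite /F/=; ring.
rewrite ge0_integral_EFin_sum//; last first.
  by move=> SS; rewrite mulr_ge0 ?weight_ge0.
pose M := expR log_moment.
apply: (@le_trans _ _ (\sum_(SS | sc2 SS)
    (wt SS.1 * wt SS.2 * M ^+ edges_between (edge Omega) SS.1 SS.2)%:E)%E).
  apply: lee_sum => -[S S'] /andP[/= sS sS'].
  rewrite [leRHS]EFinM lee_wpmul2l ?lee_fin ?mulr_ge0 ?weight_ge0//.
  exact: trunc_lr_pair.
rewrite sumEFin lee_fin.
have := sum_weight_edges e01 (edge_sym Omega_sym) degree (expR_ge0 log_moment).
by rewrite pair_big/= card_ord.
Qed.

(** Both restrictions, to scattered supports and to truncated ratios, only decrease
    the likelihood ratio. *)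
Lemma mixture_lr_domination (psi : p.-tuple R -> R) :
  measurable_fun setT psi -> (forall x, 0 <= psi x) ->
  (\int[P]_w (psi (z w) * mixture_lr w)%:E <=
   \sum_(S : {set 'I_p}) (wt S)%:E * \int[P]_w (psi (addt (spike tau S) (z w)))%:E)%E.
Proof.
move=> mpsi psi0.
have mz : measurable_fun setT z by exact: measurable_funPT.
have mpz : measurable_fun setT (fun w => psi (z w)) by exact: measurableT_comp.
have mt := measurable_trunc_lr z Omega tau t.
have ms := measurable_spike_lr z Omega tau.
under eq_integral.
  move=> w _; rewrite /mixture_lr mulr_sumr.
  under eq_bigr do rewrite mulrCA.
  over.
rewrite (@ge0_integral_EFin_sum _ _ _ _ _ _ _
  (fun S w => psi (z w) * trunc_lr S w)); last 3 first.
- by move=> S; exact: measurable_funM.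
- by move=> S w; rewrite mulr_ge0// trunc_lr_ge0.
- by move=> S; exact: weight_ge0.
rewrite [leRHS](bigID scattered)/=; apply: le_trans (leeDl _ _); last first.
  apply: sume_ge0 => S _; rewrite mule_ge0 ?lee_fin ?weight_ge0//.
  by apply: integral_ge0 => w _; rewrite lee_fin.
apply: lee_sum => S sS; rewrite lee_wpmul2l ?lee_fin ?weight_ge0//.
have mpE : measurable_fun setT (fun x => (psi x)%:E) by exact/measurable_EFinP.
rewrite (shift_spike tau shift_z Omega_diag sS mpE)//.
under [leRHS]eq_integral do rewrite -EFinM.
apply: ge0_le_integral_EFin.
- by move=> w; rewrite mulr_ge0// trunc_lr_ge0.
- exact: measurable_funM.
- exact: measurable_funM.
by move=> w; rewrite ler_wpM2l// /trunc_lr ler_piMr ?spike_lr_ge0.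
Qed.

(** Write [L] for [mixture_lr]. By the inequality of arithmetic and geometric means
    [|1 - L|] is at most [eta + (1 - L) ^+ 2 / (4 * eta)], and the second moment of
    [1 - L] is bounded by the bounds on the first two moments of [L]. *)
Lemma null_vs_mixture (psi : p.-tuple R -> R) (eta : R) :
  measurable_fun setT psi -> (forall x, 0 <= psi x <= 1) -> 0 < eta ->
  (\int[P]_w (psi (z w))%:E <=
   \sum_(S : {set 'I_p}) (wt S)%:E * \int[P]_w (psi (addt (spike tau S) (z w)))%:E +
   (eta + (second_moment_bound - 1 + mass_defect *+ 2) / (4 * eta))%:E)%E.
Proof.
move=> mpsi psi01 eta0.
have psi0 x : 0 <= psi x by have /andP[] := psi01 x.
have psi1 x : psi x <= 1 by have /andP[] := psi01 x.
pose k := (4 * eta)^-1.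
have eta_ge0 : 0 <= eta by exact: ltW.
have k0 : 0 <= k by rewrite invr_ge0 mulr_ge0.
have mz : measurable_fun setT z by exact: measurable_funPT.
have mpz : measurable_fun setT (fun w => psi (z w)) by exact: measurableT_comp.
have mL := measurable_mixture_lr; have L0 := mixture_lr_ge0.
have mL2 : measurable_fun setT (fun w => mixture_lr w ^+ 2) by exact: measurable_funX.
have key : (\int[P]_w (psi (z w) + 2 * k * mixture_lr w)%:E <=
    \int[P]_w (psi (z w) * mixture_lr w + (eta + k + k * mixture_lr w ^+ 2))%:E)%E.
  apply: ge0_le_integral_EFin.
  - by move=> w; rewrite addr_ge0// !mulr_ge0.
  - by apply: measurable_funD => //; exact: measurable_funM.
  - apply: measurable_funD; first exact: measurable_funM.
    by apply: measurable_funD => //; exact: measurable_funM.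
  move=> w; set a := psi (z w); set l := mixture_lr w.
  have a0 : 0 <= a by exact: psi0.
  have a1 : a <= 1 by exact: psi1.
  rewrite -subr_ge0.
  have -> : a * l + (eta + k + k * l ^+ 2) - (a + 2 * k * l) =
      a * (k * (1 - l - 2 * eta) ^+ 2) + (1 - a) * (eta + k * (1 - l) ^+ 2).
    by rewrite /k; field; rewrite gt_eqF.
  apply: addr_ge0; apply: mulr_ge0 => //.
  - by apply: mulr_ge0 => //; exact: sqr_ge0.
  - by rewrite subr_ge0.
  - by apply: addr_ge0 => //; apply: mulr_ge0 => //; exact: sqr_ge0.
move: key.
rewrite ge0_integral_EFinD//; last 2 first.
- by move=> w; rewrite !mulr_ge0.
- exact: measurable_funM.
rewrite ge0_integral_EFinZ//; last exact: mulr_ge0.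
rewrite ge0_integral_EFinD//; last 4 first.
- by move=> w; rewrite mulr_ge0.
- exact: measurable_funM.
- by move=> w; rewrite addr_ge0// ?mulr_ge0 ?sqr_ge0// addr_ge0.
- by apply: measurable_funD => //; exact: measurable_funM.
rewrite ge0_integral_EFinD//; last 3 first.
- by move=> w; rewrite addr_ge0.
- by move=> w; rewrite mulr_ge0 ?sqr_ge0.
- exact: measurable_funM.
rewrite integral_prob_cst ge0_integral_EFinZ//; last by move=> w; exact: sqr_ge0.
set A := (\int[P]_w (psi (z w))%:E)%E.
set B := (\int[P]_w (psi (z w) * mixture_lr w)%:E)%E.
set B' := (\sum_(S : {set 'I_p}) _)%E.
have BB' : (B <= B')%E by exact: mixture_lr_domination.
have le1 := @integral_prob_le1 R d T P.
have A1 : (A <= 1)%E by exact: le1.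
have A0 : (0 <= A)%E by apply: integral_ge0 => w _; rewrite lee_fin.
have B'1 : (B' <= 1)%E.
  have <- : (\sum_(S : {set 'I_p}) wt S)%:E = 1%E by rewrite sum_weight.
  rewrite -sumEFin; apply: lee_sum => S _; rewrite -[leRHS]mule1.
  rewrite lee_wpmul2l ?lee_fin ?weight_ge0//; apply: le1 => //.
  by apply: (measurableT_comp mpsi); apply: measurableT_comp => //; exact: measurable_addt.
have B'0 : (0 <= B')%E.
  apply: sume_ge0 => S _; rewrite mule_ge0 ?lee_fin ?weight_ge0//.
  by apply: integral_ge0 => w _; rewrite lee_fin.
have Afin : A \is a fin_num by rewrite ge0_fin_numE// (le_lt_trans A1)// ltry.
have B'fin : B' \is a fin_num by rewrite ge0_fin_numE// (le_lt_trans B'1)// ltry.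
move=> key.
have {}key : (A + (2 * k * (1 - mass_defect))%:E <=
    B' + (eta + k + k * second_moment_bound)%:E)%E.
  apply: (@le_trans _ _ (A + (2 * k)%:E * \int[P]_w (mixture_lr w)%:E)%E).
    rewrite leeD2l// EFinM lee_wpmul2l ?lee_fin ?mulr_ge0//.
    exact: mixture_lr_mass.
  apply: (le_trans key); rewrite leeD// [leRHS]EFinD leeD2l//.
  rewrite [leRHS]EFinM lee_wpmul2l ?lee_fin//.
  exact: mixture_lr_second_moment.
move: key; rewrite -(fineK Afin) -(fineK B'fin) -!EFinD !lee_fin -/k => key.
apply: le_trans (_ : _ <= fine B' + (eta + k + k * second_moment_bound) -
  2 * k * (1 - mass_defect)) _.
  by rewrite lerBrDr.
rewrite le_eqVlt; apply/orP; left; apply/eqP; rewrite -/k mulr2n; ring.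
Qed.

End testing_lower_bound.

(** * Normal tails and independence of coordinates *)

Section normal_tail.
Context (R : realType).
Local Notation N01 := (@normal_prob R 0 1).
Local Notation N01P := (normal_prob 0 1 : probability (measurableTypeR R) R).

Definition normal_tail (u : R) : R := fine (N01 `]u, +oo[).

Lemma EFin_normal_tail u : (normal_tail u)%:E = N01 `]u, +oo[%classic.
Proof. by rewrite fineK// (fin_num_measure N01P). Qed.

Lemma normal_tail_ge0 u : 0 <= normal_tail u.
Proof. by rewrite fine_ge0// (measure_ge0 N01P). Qed.

Lemma normal_tail_le1 u : normal_tail u <= 1.
Proof. by rewrite -lee_fin EFin_normal_tail (@probability_le1 _ _ _ N01P). Qed.

Lemma normal_tail_anti u v : u <= v -> normal_tail v <= normal_tail u.
Proof.
move=> uv; rewrite -lee_fin !EFin_normal_tail.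
apply: (le_measure N01P); rewrite ?inE//.
by move=> x /=; rewrite !in_itv/= !andbT; exact: le_lt_trans.
Qed.

(** Chernoff's bound: the indicator of [x > u] is at most
    [expR (u * x - u ^+ 2)]. *)
Lemma normal_tail_le u : 0 <= u -> normal_tail u <= expR (- (u ^+ 2 / 2)).
Proof.
move=> u0; rewrite -lee_fin EFin_normal_tail.
have mexp : measurable_fun setT (fun x : R => expR (u * x - u ^+ 2 / 2)).
  by apply: measurableT_comp => //; apply: measurable_funB.
have <- : (\int[N01]_x (expR (- (u ^+ 2 / 2)) * expR (u * x - u ^+ 2 / 2))%:E =
           (expR (- (u ^+ 2 / 2)))%:E)%E.
  rewrite (@ge0_integral_EFinZ _ _ _ N01P)//.
  have := @normal01_shift R u (cst 1%E) (measurable_cst _) (fun=> lee01).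
  have -> : (\int[N01]_x (cst 1 (x + u)%R) = 1 :> \bar R)%E.
    exact: (integral_prob_cst N01P 1).
  move=> int1; rewrite -[RHS]mule1 [X in _ = (_ * X)%E]int1; congr (_ * _)%E.
  by apply: eq_integral => x _; rewrite /= mul1e.
rewrite -(setIT `]u, +oo[%classic) -(@integral_indic _ _ _ N01P)//.
apply: (@ge0_le_integral_EFin _ _ _ N01P) => //.
  by apply: measurable_funM.
move=> x; rewrite indicE; have [|_] := boolP (x \in _); last first.
  by rewrite mulr_ge0// expR_ge0.
rewrite inE/= in_itv/= andbT => ux; rewrite -expRD -[leLHS]expR0 ler_expR.
rewrite [leRHS](_ : _ = u * (x - u)); last by field.
by rewrite mulr_ge0// subr_ge0 ltW.
Qed.

(** The density on [[u, u + 1]] is at least its value at the right end. *)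
Lemma normal_tail_ge u : 0 <= u -> normal_pdf 0 1 (u + 1) <= normal_tail u.
Proof.
move=> u0; rewrite -lee_fin EFin_normal_tail.
have mpdf := @measurable_normal_pdf R 0 1.
apply: (@le_trans _ _ (N01 `]u, (u + 1)]%classic)); last first.
  apply: (le_measure N01P); rewrite ?inE//.
  by move=> x /=; rewrite !in_itv/= => /andP[->].
rewrite /normal_prob.
apply: (@le_trans _ _ (\int[lebesgue_measure]_(x in `]u, (u + 1)%R]%classic)
    (normal_pdf 0 1 (u + 1))%:E)%E).
  rewrite integral_cst//= lebesgue_measure_itv/= lte_fin ltrDl ltr01.
  have -> : ((u + 1)%:E - u%:E = 1)%E by rewrite -EFinB addrAC subrr add0r.
  by rewrite mule1.
apply: ge0_le_integral => //.
- by move=> x _; rewrite lee_fin normal_pdf_ge0.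
- by apply: measurable_funTS; apply/measurable_EFinP.
move=> x /=; rewrite in_itv/= => /andP[ux xu1].
rewrite lee_fin !normal_pdfE ?oner_neq0// ler_wpM2l ?normal_peak_ge0//.
rewrite /normal_fun ler_expR !subr0 ler_wpM2r ?invr_ge0//.
rewrite lerN2 ler_sqr// nnegrE.
  by rewrite (le_trans u0)// ltW.
by rewrite addr_ge0.
Qed.

End normal_tail.

Section innovation_law.
Context (R : realType) (d : measure_display) (T : measurableType d)
  (P : probability T R) (p : nat) (z : {RV P >-> p.-tuple R})
  (Omega : 'M[R]_p).
Hypothesis shift_z : gaussian_shift z Omega.
Hypothesis Omega_sym : forall i j, Omega i j = Omega j i.
Hypothesis Omega_diag : forall i, Omega i i = 1.
Local Notation X := (innovation z Omega).
Local Notation N01 := (@normal_prob R 0 1).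

Lemma mulmxt_addt (A : 'M[R]_p) (x y : p.-tuple R) i :
  tnth (mulmxt A (addt x y)) i = tnth (mulmxt A x) i + tnth (mulmxt A y) i.
Proof. by rewrite !tnth_mulmxt colt_addt mulmxDr mxE. Qed.

Lemma mulmxt_single (A : 'M[R]_p) i h k :
  tnth (mulmxt A (single i h)) k = A k i * h.
Proof.
rewrite tnth_mktuple (bigD1 i)//= tnth_mktuple eqxx big1 ?addr0// => j ji.
by rewrite tnth_mktuple (negbTE ji) mulr0.
Qed.

(** [normal_of_shift] applies to every event that is invariant under
    translations of [z] along the [i]th axis. *)
Lemma innovation_indep_event i (A : set (p.-tuple R)) (B : set R) :
  measurable A -> measurable B ->
  (forall h x, A (addt (single i h) x) <-> A x) ->
  P ((z @^-1` A) `&` (X i @^-1` B)) = (P (z @^-1` A) * N01 B)%E.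
Proof.
move=> mA mB Ainv.
have mz : measurable_fun setT z by exact: measurable_funPT.
have mzA : measurable (z @^-1` A) by rewrite -[X in measurable X]setTI; exact: mz.
apply: normal_of_shift => //; first exact: measurable_innovation.
move=> h f mf f0.
pose psi (x : p.-tuple R) := (f (tnth (mulmxt Omega x) i) * (\1_A x)%:E)%E.
have mpsi : measurable_fun setT psi.
  apply: emeasurable_funM.
    apply: (measurableT_comp mf); apply: (measurableT_comp (measurable_tnth i)).
    exact: measurable_mulmxt.
  by apply/measurable_EFinP; exact: measurable_indic.
have psi0 x : (0 <= psi x)%E by rewrite mule_ge0// lee_fin.
have := @shift_z (single i h) psi mpsi psi0.
under eq_integral => w _.
  rewrite /psi mulmxt_addt mulmxt_single Omega_diag mul1r addrC.
  have -> : \1_A (addt (single i h) (z w)) = \1_(z @^-1` A) w :> R.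
    rewrite !indicE; congr (_%:R); congr nat_of_bool.
    by apply/idP/idP; rewrite !inE => /Ainv.
  over.
move=> ->; apply: eq_integral => w _; rewrite /psi; congr (_ * (expR _)%:E)%E.
have dot_single (v : 'I_p -> R) : \sum_k tnth (single i h) k * v k = h * v i.
  rewrite (bigD1 i)//= tnth_mktuple eqxx big1 ?addr0// => k ki.
  by rewrite tnth_mktuple (negbTE ki) mul0r.
rewrite !dot_single.
by rewrite mulmxt_single Omega_diag mul1r expr2.
Qed.

Lemma innovation_law i (B : set R) : measurable B -> P (X i @^-1` B) = N01 B.
Proof.
move=> mB; have := @innovation_indep_event i setT B measurableT mB.
rewrite preimage_setT setTI => -> //.
have PT : P setT = 1%E := probability_setT P.
by rewrite PT mul1e.
Qed.

Lemma innovation_indep i j (B C : set R) : Omega i j = 0 ->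
  measurable B -> measurable C ->
  P ((X j @^-1` C) `&` (X i @^-1` B)) = (N01 C * N01 B)%E.
Proof.
move=> ij mB mC; rewrite -(innovation_law j mC).
pose A := [set x : p.-tuple R | C (tnth (mulmxt Omega x) j)].
have mA : measurable A.
  rewrite -[X in measurable X]setTI.
  apply: (measurableT_comp (measurable_tnth j) (measurable_mulmxt Omega)) => //.
apply: (@innovation_indep_event i A B mA mB) => h x.
by rewrite /A /= mulmxt_addt mulmxt_single Omega_sym ij mul0r add0r.
Qed.

End innovation_law.

(** * Counting exceedances *)

Section exceedance_count.
Context (R : realType) (d : measure_display) (T : measurableType d)
  (P : probability T R) (p : nat) (z : {RV P >-> p.-tuple R})
  (Omega : 'M[R]_p) (D : nat) (e tau t : R).
Hypothesis shift_z : gaussian_shift z Omega.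
Hypothesis Omega_sym : forall i j, Omega i j = Omega j i.
Hypothesis Omega_diag : forall i, Omega i i = 1.
Hypothesis degree : forall i, (#|[pred j | edge Omega i j]| <= D)%N.
Hypothesis e01 : 0 <= e <= 1.
Implicit Types (S : {set 'I_p}).

Local Notation X := (innovation z Omega).
Local Notation wt := (support_weight e).
Local Notation common := (common_neighbour (edge Omega)).

Definition exceeds (i : 'I_p) (y : p.-tuple R) : R :=
  (t < tnth (mulmxt Omega y) i)%R%:R.

Definition count_exceed (y : p.-tuple R) : R := \sum_i exceeds i y.

Definition mean_shift S (i : 'I_p) : R := tnth (mulmxt Omega (spike tau S)) i.

Definition exceed_prob S (i : 'I_p) : R := normal_tail (t - mean_shift S i).

Definition mean_count : R := \sum_(S : {set 'I_p}) wt S * \sum_i exceed_prob S i.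

Lemma measurable_exceeds i : measurable_fun setT (exceeds i).
Proof.
have mO := measurableT_comp (measurable_tnth i) (measurable_mulmxt Omega).
rewrite (_ : exceeds i = (\1_(`]t, +oo[) : R -> R) \o (fun y => tnth (mulmxt Omega y) i)).
  by apply: measurableT_comp => //; exact: measurable_indic.
apply/funext => y; rewrite /exceeds /= indicE; congr (_%:R).
by congr nat_of_bool; apply/idP/idP; rewrite inE/= in_itv/= andbT.
Qed.

Lemma measurable_count_exceed : measurable_fun setT count_exceed.
Proof. by apply: measurable_sum => i; exact: measurable_exceeds. Qed.

Lemma exceeds_spike S i w :
  exceeds i (addt (spike tau S) (z w)) =
  \1_(X i @^-1` `]t - mean_shift S i, +oo[) w.
Proof.
rewrite /exceeds mulmxt_addt indicE; congr (_%:R); congr nat_of_bool.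
by apply/idP/idP; rewrite inE/= in_itv/= andbT ltrBlDl.
Qed.

Let mX i (u : R) : measurable (X i @^-1` `]u, +oo[).
Proof. by rewrite -[X in measurable X]setTI; apply: measurable_innovation. Qed.

Lemma integral_exceeds S i :
  (\int[P]_w (exceeds i (addt (spike tau S) (z w)))%:E = (exceed_prob S i)%:E)%E.
Proof.
under eq_integral do rewrite exceeds_spike.
rewrite integral_indic// setIT /exceed_prob EFin_normal_tail.
exact: (innovation_law shift_z Omega_diag).
Qed.

Lemma integral_exceeds2 S i j : Omega i j = 0 ->
  (\int[P]_w (exceeds i (addt (spike tau S) (z w)) *
              exceeds j (addt (spike tau S) (z w)))%:E =
   (exceed_prob S i * exceed_prob S j)%:E)%E.
Proof.
move=> ij; under eq_integral.
  move=> w _; rewrite !exceeds_spike.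
  have -> : \1_(X i @^-1` `]t - mean_shift S i, +oo[) w *
      \1_(X j @^-1` `]t - mean_shift S j, +oo[) w =
      \1_((X i @^-1` `]t - mean_shift S i, +oo[) `&`
          (X j @^-1` `]t - mean_shift S j, +oo[)) w :> R by rewrite indicI.
  over.
rewrite integral_indic//; last exact: measurableI.
rewrite setIT EFinM /exceed_prob !EFin_normal_tail.
by apply: (innovation_indep shift_z Omega_sym Omega_diag) => //; rewrite Omega_sym.
Qed.

Lemma exceed_prob01 S i : 0 <= exceed_prob S i <= 1.
Proof. by rewrite normal_tail_ge0 normal_tail_le1. Qed.

(** The mean of coordinate [i] of [Omega Y] depends on the support only through
    the neighbours of [i]. *)
Lemma exceed_prob_local S i :
  exceed_prob S i = exceed_prob (S :&: [set j | edge Omega i j]%SET) i.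
Proof.
rewrite /exceed_prob /mean_shift !tnth_mktuple; congr (normal_tail (_ - _)).
apply: eq_bigr => j _; rewrite !tnth_mktuple !inE /edge.
by have [->|_] := eqVneq (Omega i j) 0; rewrite ?mul0r ?andbT.
Qed.

(* The probability that coordinate [i] exceeds [t] under the mixture. *)
Let A i : R := \sum_(S : {set 'I_p}) wt S * exceed_prob S i.

Let A_ge0 i : 0 <= A i.
Proof.
apply: sumr_ge0 => S _; rewrite mulr_ge0 ?weight_ge0//.
by have /andP[] := exceed_prob01 S i.
Qed.

Let mean_countE : mean_count = \sum_i A i.
Proof.
rewrite /mean_count; under eq_bigr do rewrite mulr_sumr.
exact: exchange_big.
Qed.

(** Without a common neighbour the two conditional probabilities are functions of
    disjoint parts of the support. *)
Lemma mean_exceed_prod i j : ~~ common i j ->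
  \sum_(S : {set 'I_p}) wt S * (exceed_prob S i * exceed_prob S j) = A i * A j.
Proof.
move=> nij; apply: (@sum_weight_indep _ _ _ [set k | edge Omega i k]%SET).
  by move=> S; exact: exceed_prob_local.
move=> S; rewrite (exceed_prob_local S j) (exceed_prob_local (S :\: _) j).
suff -> : (S :\: [set k | edge Omega i k]%SET) :&: [set k | edge Omega j k]%SET =
    S :&: [set k | edge Omega j k]%SET by [].
apply/setP => k; rewrite !inE; case jk : (edge Omega j k); rewrite ?andbF// !andbT.
case ik : (edge Omega i k) => //.
by move: nij => /existsPn/(_ k); rewrite ik jk.
Qed.

(** Chebyshev's inequality: coordinates of [Omega Y] without a common neighbour
    are independent, so that the variance of the count is at most [D ^ 2] times
    its mean. *)
Lemma count_chebyshev (chi : p.-tuple R -> R) (k : R) :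
  measurable_fun setT chi -> (forall y, 0 <= chi y <= 1) -> 0 <= k ->
  (forall y, k * chi y <= (count_exceed y - mean_count) ^+ 2) ->
  (k%:E * \sum_(S : {set 'I_p}) (wt S)%:E * \int[P]_w (chi (addt (spike tau S) (z w)))%:E
   <= (D%:R ^+ 2 * mean_count)%:E)%E.
Proof.
move=> mchi chi01 k0 chik.
have chi0 y : 0 <= chi y by have /andP[] := chi01 y.
have mz : measurable_fun setT z by exact: measurable_funPT.
have mu0 : 0 <= mean_count by rewrite mean_countE sumr_ge0.
pose y S w := addt (spike tau S) (z w).
have my S : measurable_fun setT (y S).
  by apply: measurableT_comp mz; exact: measurable_addt.
(* For related coordinates the probability of a joint exceedance is bounded by
   that of a single one. *)
pose B i j S : R := if common i j then exceed_prob S i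
  else exceed_prob S i * exceed_prob S j.
have intB i j S : (\int[P]_w (exceeds i (y S w) * exceeds j (y S w))%:E <= (B i j S)%:E)%E.
  rewrite /B; case: ifPn => [_|nij].
    rewrite -integral_exceeds; apply: ge0_le_integral_EFin.
    - by move=> w; rewrite mulr_ge0.
    - by apply: measurable_funM; apply: (measurableT_comp _ (my S)); exact: measurable_exceeds.
    - by apply: (measurableT_comp _ (my S)); exact: measurable_exceeds.
    - by move=> w; rewrite ler_piMr// /exceeds; case: (_ < _).
  rewrite integral_exceeds2//; apply/eqP; apply: contraNT nij => ij.
  exact: (common_neighbour_edge (edge_refl Omega_diag)).
have perS S : (k%:E * \int[P]_w (chi (y S w))%:E +
    (2 * mean_count * \sum_i exceed_prob S i)%:E <=
    (\sum_i \sum_j B i j S + mean_count ^+ 2)%:E)%E.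
  have mchiy : measurable_fun setT (fun w => chi (y S w)) by exact: measurableT_comp.
  have mex i : measurable_fun setT (fun w => exceeds i (y S w)).
    by apply: (measurableT_comp _ (my S)); exact: measurable_exceeds.
  have mN : measurable_fun setT (fun w => count_exceed (y S w)).
    by apply: (measurableT_comp _ (my S)); exact: measurable_count_exceed.
  have N0 w : 0 <= count_exceed w by apply: sumr_ge0.
  have intN : (\int[P]_w (count_exceed (y S w))%:E = (\sum_i exceed_prob S i)%:E)%E.
    have := @ge0_integral_EFin_sum _ _ _ P _ xpredT (fun=> 1)
      (fun i w => exceeds i (y S w)) mex (fun _ _ => ler0n _ _) (fun=> ler01).
    rewrite (_ : (fun w => _) = (fun w => (count_exceed (y S w))%:E)); last first.
      by apply/funext => w; under eq_bigr do rewrite mul1r.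
    move=> ->; rewrite -sumEFin; apply: eq_bigr => i _.
    by rewrite mul1e integral_exceeds.
  have intN2 : (\int[P]_w (count_exceed (y S w) ^+ 2)%:E <= (\sum_i \sum_j B i j S)%:E)%E.
    pose F (ij : 'I_p * 'I_p) w := exceeds ij.1 (y S w) * exceeds ij.2 (y S w).
    have mF ij : measurable_fun setT (F ij) by exact: measurable_funM.
    have F0 ij w : 0 <= F ij w by rewrite mulr_ge0.
    rewrite (_ : (fun w => _) = (fun w => (\sum_ij 1 * F ij w)%:E)); last first.
      apply/funext => w; congr EFin; rewrite expr2 /count_exceed big_distrlr/=.
      by rewrite pair_big/=; apply: eq_bigr => ij _; rewrite mul1r.
    rewrite ge0_integral_EFin_sum// pair_big/= -sumEFin.
    by apply: lee_sum => -[i j] _; rewrite mul1e; exact: intB.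
  rewrite -ge0_integral_EFinZ// EFinM -intN -ge0_integral_EFinZ//; last exact: mulr_ge0.
  rewrite -ge0_integral_EFinD//; last 4 first.
  - by move=> w; rewrite mulr_ge0.
  - exact: measurable_funM.
  - by move=> w; rewrite !mulr_ge0.
  - exact: measurable_funM.
  rewrite EFinD; apply: le_trans (leeD intN2 (lexx _)).
  rewrite -(integral_prob_cst P (mean_count ^+ 2)) -ge0_integral_EFinD//; last 3 first.
  - by move=> w; exact: sqr_ge0.
  - exact: measurable_funX.
  - by move=> _; exact: sqr_ge0.
  apply: ge0_le_integral_EFin.
  - by move=> w; rewrite addr_ge0// !mulr_ge0.
  - by apply: measurable_funD; exact: measurable_funM.
  - by apply: measurable_funD => //; exact: measurable_funX.
  move=> w; have := chik (y S w); rewrite sqrrB; set n := count_exceed _.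
  by rewrite -mulr_natr; lra.
pose Q : \bar R := (\sum_(S : {set 'I_p}) (wt S)%:E * \int[P]_w (chi (y S w))%:E)%E.
have Q0 : (0 <= Q)%E.
  apply: sume_ge0 => S _; rewrite mule_ge0 ?lee_fin ?weight_ge0//.
  by apply: integral_ge0 => w _; rewrite lee_fin.
have total : (k%:E * Q + (2 * mean_count * mean_count)%:E <=
    (\sum_(S : {set 'I_p}) wt S * (\sum_i \sum_j B i j S) + mean_count ^+ 2)%:E)%E.
  have -> : (k%:E * Q + (2 * mean_count * mean_count)%:E =
      \sum_(S : {set 'I_p}) (wt S)%:E * (k%:E * \int[P]_w (chi (y S w))%:E +
    (2 * mean_count * \sum_i exceed_prob S i)%:E))%E.
    have -> : 2 * mean_count * mean_count =
        \sum_(S : {set 'I_p}) wt S * (2 * mean_count * \sum_i exceed_prob S i).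
      rewrite [in LHS]/mean_count mulr_sumr; apply: eq_bigr => S _.
      by rewrite mulrCA.
    rewrite /Q ge0_sume_distrr; last first.
      move=> S _; rewrite mule_ge0 ?lee_fin ?weight_ge0//.
      by apply: integral_ge0 => w _; rewrite lee_fin.
    rewrite -sumEFin -big_split; apply: eq_bigr => S _ /=.
    rewrite [RHS]muleDr ?fin_num_adde_defl// -EFinM; congr (_ + _)%E.
    by rewrite muleCA.
  have -> : \sum_(S : {set 'I_p}) wt S * (\sum_i \sum_j B i j S) + mean_count ^+ 2 =
      \sum_(S : {set 'I_p}) wt S * (\sum_i \sum_j B i j S + mean_count ^+ 2).
    under [RHS]eq_bigr do rewrite mulrDr.
    by rewrite big_split/= -mulr_suml sum_weight mul1r.
  rewrite -sumEFin; apply: lee_sum => S _.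
  by rewrite [leRHS]EFinM lee_wpmul2l ?lee_fin ?weight_ge0.
have sumB : \sum_(S : {set 'I_p}) wt S * (\sum_i \sum_j B i j S) <=
    mean_count ^+ 2 + D%:R ^+ 2 * mean_count.
  have -> : \sum_(S : {set 'I_p}) wt S * (\sum_i \sum_j B i j S) =
      \sum_i \sum_j (\sum_(S : {set 'I_p}) wt S * B i j S).
    under eq_bigr do rewrite mulr_sumr.
    rewrite exchange_big/=; apply: eq_bigr => i _.
    under eq_bigr do rewrite mulr_sumr.
    by rewrite exchange_big.
  have -> : mean_count ^+ 2 + D%:R ^+ 2 * mean_count =
      \sum_i (\sum_j A i * A j + D%:R ^+ 2 * A i).
    rewrite big_split/= -mulr_sumr -mean_countE; congr (_ + _).
    by rewrite expr2 mean_countE big_distrlr.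
  apply: ler_sum => i _.
  apply: (@le_trans _ _ (\sum_j (A i * A j + (common i j)%:R * A i))).
    apply: ler_sum => j _; rewrite /B; case: (boolP (common i j)) => [_|nij] /=.
      by rewrite mul1r lerDr; apply: mulr_ge0; exact: A_ge0.
    by rewrite mean_exceed_prod// mul0r addr0.
  rewrite big_split/= lerD2l -mulr_suml ler_wpM2r// -natr_sum -natrX ler_nat.
  have := card_common_neighbour (edge_sym Omega_sym) degree i.
  by rewrite -sum1_card big_mkcond/=.
have Qfin : (k%:E * Q)%E \is a fin_num.
  rewrite ge0_fin_numE; last by rewrite mule_ge0.
  apply: le_lt_trans (_ : _ <= k%:E * 1)%E _; last by rewrite mule1 ltry.
  rewrite lee_wpmul2l//.
  have <- : (\sum_(S : {set 'I_p}) wt S)%:E = 1%E by rewrite sum_weight.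
  rewrite -sumEFin; apply: lee_sum => S _; rewrite -[leRHS]mule1.
  rewrite lee_wpmul2l ?lee_fin ?weight_ge0//; apply: integral_prob_le1 => //.
  exact: measurableT_comp.
move: total; rewrite -/Q -(fineK Qfin) -EFinD !lee_fin => total.
by move: sumB total; rewrite expr2; set b := \sum_(S : {set 'I_p}) _; lra.
Qed.

End exceedance_count.

Section count_test.
Context (R : realType) (d : measure_display) (T : measurableType d)
  (P : probability T R) (p : nat) (z : {RV P >-> p.-tuple R})
  (Omega : 'M[R]_p) (D : nat) (e t c : R).
Hypothesis shift_z : gaussian_shift z Omega.
Hypothesis Omega_sym : forall i j, Omega i j = Omega j i.
Hypothesis Omega_diag : forall i, Omega i i = 1.
Hypothesis degree : forall i, (#|[pred j | edge Omega i j]| <= D)%N.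
Hypothesis e01 : 0 <= e <= 1.
Hypothesis c0 : 0 < c.
Implicit Types (S : {set 'I_p}) (tau : R).

Local Notation wt := (support_weight e).
Local Notation count := (count_exceed Omega t).
Local Notation mean := (mean_count Omega e).

Definition null_mean : R := p%:R * normal_tail t.

Definition count_test (y : p.-tuple R) : R := (null_mean + c < count y)%R%:R.

Lemma null_mean_ge0 : 0 <= null_mean.
Proof. by rewrite mulr_ge0// normal_tail_ge0. Qed.

Lemma measurable_count_test : measurable_fun setT count_test.
Proof.
have mc := measurable_count_exceed Omega t.
rewrite (_ : count_test = (\1_(`]null_mean + c, +oo[) : R -> R) \o count).
  by apply: measurableT_comp => //; exact: measurable_indic.
apply/funext => y; rewrite /count_test /= indicE; congr (_%:R).
by congr nat_of_bool; apply/idP/idP; rewrite inE/= in_itv/= andbT.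
Qed.

Lemma count_test01 y : 0 <= count_test y <= 1.
Proof. by rewrite /count_test; case: (_ < _)%R; rewrite ?lexx ler01. Qed.

Lemma mean_shift_avoid tau S i : S :&: [set j | edge Omega i j]%SET = finset.set0 ->
  mean_shift Omega tau S i = 0.
Proof.
move=> /setP S0; rewrite /mean_shift tnth_mktuple big1// => j _.
rewrite tnth_mktuple; have := S0 j; rewrite !inE /edge.
have [->|_] := eqVneq (Omega i j) 0; first by rewrite mul0r.
by rewrite andbT => ->; rewrite mulr0.
Qed.

Lemma mean_shift_alone tau S i : S :&: [set j | edge Omega i j]%SET = [set i]%SET ->
  mean_shift Omega tau S i = tau.
Proof.
move=> /setP S1; rewrite /mean_shift tnth_mktuple (bigD1 i)//= big1 => [|j ji].
  have := S1 i; rewrite !inE eqxx => /andP[iS _].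
  by rewrite tnth_mktuple iS Omega_diag mul1r addr0.
rewrite tnth_mktuple; have := S1 j; rewrite !inE /edge (negbTE ji).
have [->|_] := eqVneq (Omega i j) 0; first by rewrite mul0r.
by rewrite andbT => ->; rewrite mulr0.
Qed.

(** A coordinate whose neighbourhood carries no signal keeps its null law, and
    one whose only neighbouring signal is its own is shifted by exactly [tau]. *)
Lemma mean_count_ge tau : p%:R * ((1 - D%:R * e) * normal_tail t +
    (e - D%:R * e ^+ 2) * normal_tail (t - tau)) <= mean tau t.
Proof.
have /andP[e0 e1] := e01.
rewrite /mean_count; under [leRHS]eq_bigr do rewrite mulr_sumr.
rewrite exchange_big/= [leLHS]mulr_natl -[X in _ *+ X](card_ord p) -sumr_const.
apply: ler_sum => i _.
pose N := [set j | edge Omega i j]%SET.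
have iN : i \in N by rewrite inE edge_refl.
have cardN : (#|N| <= D)%N.
  apply: leq_trans (degree i); apply: subset_leq_card.
  by apply/fintype.subsetP => j; rewrite !inE.
have cardNR : #|N|%:R <= D%:R :> R by rewrite ler_nat.
have tt := normal_tail_ge0 t; have ttau := normal_tail_ge0 (t - tau).
apply: (@le_trans _ _ (\sum_(S : {set 'I_p}) wt S *
   ((S :&: N == finset.set0)%:R * normal_tail t +
    (S :&: N == [set i]%SET)%:R * normal_tail (t - tau)))); last first.
  apply: ler_sum => S _; apply: ler_wpM2l; first exact: weight_ge0.
  rewrite /exceed_prob.
  have [S0|_] := eqVneq (S :&: N) finset.set0.
    rewrite S0 eq_sym (_ : ([set i]%SET == finset.set0) = false); last first.
      by apply/negbTE/set0Pn; exists i; rewrite inE.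
    by rewrite mul1r mul0r addr0 mean_shift_avoid ?subr0.
  have [S1|_] := eqVneq (S :&: N) [set i]%SET.
    by rewrite mul1r mul0r add0r mean_shift_alone.
  by rewrite !mul0r addr0 normal_tail_ge0.
under eq_bigr do rewrite mulrDr !mulrA.
rewrite big_split/= -!mulr_suml; apply: lerD; apply: ler_wpM2r => //.
  apply: le_trans (sum_weight_avoid e01 N).
  by rewrite lerD2l lerN2 ler_wpM2r.
apply: le_trans (sum_weight_alone e01 iN).
by rewrite lerD2l lerN2 ler_wpM2r ?sqr_ge0.
Qed.

Lemma mean_count0 tau : mean_count Omega 0 tau t = null_mean.
Proof.
rewrite /mean_count (bigD1 finset.set0)//= support_weight0 eqxx mul1r.
rewrite [X in _ + X]big1 ?addr0; last first.
  by move=> S /negbTE S0; rewrite support_weight0 S0 mul0r.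
rewrite (eq_bigr (fun=> normal_tail t)) => [|i _].
  by rewrite sumr_const card_ord /null_mean mulr_natl.
by rewrite /exceed_prob mean_shift_avoid ?subr0// finset.set0I.
Qed.

(** The null hypothesis is the mixture with [e = 0]. *)
Lemma count_test_type1 :
  (\int[P]_w (count_test (z w))%:E <= (D%:R ^+ 2 * null_mean / c ^+ 2)%:E)%E.
Proof.
have c2 : 0 < c ^+ 2 by exact: exprn_gt0.
have e01' : 0 <= (0 : R) <= 1 by rewrite lexx ler01.
have bound y : c ^+ 2 * count_test y <= (count y - mean_count Omega 0 0 t) ^+ 2.
  rewrite mean_count0 /count_test; case: ltP => [lt|_]; last by rewrite mulr0 sqr_ge0.
  have cle : c <= count y - null_mean by rewrite lerBrDl ltW.
  by rewrite mulr1 ler_sqr ?nnegrE ?(ltW c0) ?(le_trans (ltW c0) cle).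
have := count_chebyshev shift_z Omega_sym Omega_diag degree e01'
  measurable_count_test count_test01 (ltW c2) bound.
rewrite mean_count0 (bigD1 finset.set0)//= support_weight0 eqxx mul1e.
rewrite [X in (_ + X)%E]big1 ?adde0; last first.
  by move=> S /negbTE S0; rewrite support_weight0 S0 mul0e.
have -> : (\int[P]_w (count_test (addt (spike 0 finset.set0) (z w)))%:E =
    \int[P]_w (count_test (z w))%:E)%E.
  apply: eq_integral => w _; congr (count_test _)%:E.
  by apply: eq_from_tnth => i; rewrite !tnth_mktuple inE add0r.
by rewrite EFinM -lee_pdivlMl// muleC.
Qed.

(** The bound of [count_chebyshev] decreases in the mean once the mean exceeds
    the critical value of the test, so the lower bound on the mean can be used in
    its place. *)
Lemma count_test_type2 tau : null_mean + 2 * c <= mean tau t ->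
  (\sum_(S : {set 'I_p}) (wt S)%:E *
     \int[P]_w (1 - count_test (addt (spike tau S) (z w)))%:E <=
   (D%:R ^+ 2 * (null_mean + 2 * c) / c ^+ 2)%:E)%E.
Proof.
move=> mean_ge; have m0 := null_mean_ge0.
pose g := mean tau t - null_mean - c.
have g0 : 0 < g.
  rewrite /g -addrA -opprD subr_gt0 (lt_le_trans _ mean_ge)// ltrD2l.
  by rewrite mulr_natl mulr2n ltrDl.
have g2 : 0 < g ^+ 2 by exact: exprn_gt0.
have mchi : measurable_fun setT (fun y => 1 - count_test y).
  by apply: measurable_funB => //; exact: measurable_count_test.
have chi01 y : 0 <= 1 - count_test y <= 1.
  by have := count_test01 y => /andP[? ?]; apply/andP; split; lra.
have bound y : g ^+ 2 * (1 - count_test y) <= (count y - mean tau t) ^+ 2.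
  rewrite /count_test; case: ltP => [_|le]; first by rewrite subrr mulr0 sqr_ge0.
  have gle : g <= mean tau t - count y by rewrite /g -addrA -opprD lerD2l lerN2.
  rewrite subr0 mulr1 -[leRHS]sqrrN opprB.
  by rewrite ler_sqr ?nnegrE ?(ltW g0) ?(le_trans (ltW g0) gle).
have := count_chebyshev shift_z Omega_sym Omega_diag degree e01
  mchi chi01 (ltW g2) bound.
rewrite -lee_pdivlMl// => /le_trans; apply.
pose b := null_mean + 2 * c; pose v := mean tau t - b.
have [v0 c_ge0] : 0 <= v /\ 0 <= c by split; [rewrite subr_ge0|exact: ltW].
have gE : g = v + c by rewrite /g /v /b; ring.
have meanE : mean tau t = v + b by rewrite subrK.
have bc : 2 * c <= b by rewrite lerDr.
have frac : mean tau t / g ^+ 2 <= b / c ^+ 2.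
  rewrite ler_pdivlMr ?exprn_gt0// mulrAC ler_pdivrMr// meanE gE.
  move: v0 c_ge0 bc; move: (v) (b) (c) => v' b' c' v0 c_ge0 bc.
  have vv : 0 <= v' * (b' * v') by rewrite !mulr_ge0// (le_trans _ bc)// mulr_ge0.
  have vc : 0 <= v' * c' * (b' - 2 * c') by rewrite !mulr_ge0// subr_ge0.
  have vc2 : 0 <= v' * (c' * c') by rewrite !mulr_ge0.
  by rewrite !expr2; nra.
rewrite -EFinM lee_fin.
rewrite (_ : _^-1 * _ = D%:R ^+ 2 * (mean tau t / g ^+ 2)); last by rewrite mulrC mulrA.
rewrite -/b [leRHS](_ : _ = D%:R ^+ 2 * (b / c ^+ 2)); last by rewrite mulrA.
by apply: ler_wpM2l => //; exact: sqr_ge0.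
Qed.

End count_test.

(** * The risk of a test at a fixed dimension *)

Section precision.
Context (R : realType) (p : nat) (Sigma Omega : 'M[R]_p).
Hypothesis cov : is_covariance Sigma.
Hypothesis prec : is_precision Omega Sigma.

Lemma precision_tr : Omega^T = Omega.
Proof. by have [_ ->] := prec; rewrite trmx_inv cov.1. Qed.

Lemma precision_sym i j : Omega i j = Omega j i.
Proof. by rewrite -[in LHS]precision_tr mxE. Qed.

Lemma precision_psd (u : 'cV[R]_p) : 0 <= (u^T *m Omega *m u) 0 0.
Proof.
have := cov.2 (Omega *m u); rewrite trmx_mul precision_tr.
by have [uS ->] := prec; rewrite -!mulmxA mulKVmx.
Qed.

(** A correlation coefficient is at most one. *)
Lemma precision_le1 : (forall i, Omega i i = 1) -> forall i j, Omega i j <= 1.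
Proof.
move=> diag i j; have [->|ij] := eqVneq i j; first by rewrite diag.
pose u : 'cV[R]_p := delta_mx i 0 - delta_mx j 0.
have entry a b : ((delta_mx a 0 : 'cV[R]_p)^T *m Omega *m (delta_mx b 0 : 'cV[R]_p)) 0 0
    = Omega a b.
  by rewrite trmx_delta -rowE -colE !mxE.
have sub00 (M N : 'M[R]_1) : (M - N) 0 0 = M 0 0 - N 0 0 by rewrite !mxE.
have := precision_psd u.
have -> : u^T = (delta_mx i 0)^T - (delta_mx j 0)^T by rewrite linearB.
rewrite /u !mulmxBl !mulmxBr !sub00 !entry !diag (precision_sym j i).
by lra.
Qed.

End precision.

Section signal_mixture.
Context (R : realType) (d : measure_display) (T : measurableType d)
  (P : probability T R) (p : nat) (beta z : {RV P >-> p.-tuple R}) (theta r : R).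
Hypothesis iid_beta : iid beta (spike_law theta r p).
Hypothesis indep : independent beta z.
Local Notation e := (eps theta p).
Local Notation tau := (tau r p).
Hypothesis e01 : 0 <= e <= 1.
Hypothesis tau0 : tau != 0.
Implicit Types (S : {set 'I_p}).
Local Notation wt := (support_weight e).

Let point S : set (p.-tuple R) := box (fun i => [set if i \in S then tau else 0]).

Let measurable_point S : measurable (point S).
Proof. by apply: measurable_box => i; exact: measurable_set1. Qed.

Let pointE S x : point S x <-> x = spike tau S.
Proof.
split=> [Sx|->] => [|i]; last by rewrite tnth_mktuple.
by apply: eq_from_tnth => i; rewrite Sx tnth_mktuple.
Qed.

Let spike_inj : injective (@spike R p tau).
Proof.
move=> S S' SS'; apply/setP => i; have := congr1 (fun x : p.-tuple R => tnth x i) SS'.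
rewrite /= !tnth_mktuple; case: (i \in S); case: (i \in S') => // /eqP.
  by rewrite (negbTE tau0).
by rewrite eq_sym (negbTE tau0).
Qed.

Lemma prob_spike S : P (beta @^-1` point S) = (wt S)%:E.
Proof.
have [ind ident] := iid_beta.
pose B i : set R := [set if i \in S then tau else 0].
transitivity (\prod_(i < p) P [set w | B i (tnth (beta w) i)])%E.
  by apply: (ind B) => i; exact: measurable_set1.
rewrite /support_weight -prodEFin; apply: eq_bigr => i _.
transitivity (spike_law theta r p (B i)).
  by apply: (ident i (B i)); exact: measurable_set1.
rewrite /spike_law /B !diracE.
case: ifP => _.
  rewrite (memNset (_ : ~ [set tau] 0)) ?mem_set//=; last first.
    by move=> /= t0; move: tau0; rewrite -t0 eqxx.
  by rewrite mule0 add0e mule1.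
rewrite mem_set//= memNset/=; last by move=> t0; move: tau0; rewrite t0 eqxx.
by rewrite mule0 adde0 mule1.
Qed.

(** The events [beta = spike tau S] are disjoint and independent of [z]. *)
Lemma signal_mixture_le (psi : p.-tuple R -> R) :
  measurable_fun setT psi -> (forall x, 0 <= psi x) ->
  (\sum_(S : {set 'I_p}) (wt S)%:E * \int[P]_w (psi (addt (spike tau S) (z w)))%:E <=
   \int[P]_w (psi (addt (beta w) (z w)))%:E)%E.
Proof.
move=> mpsi psi0.
have mz : measurable_fun setT z by exact: measurable_funPT.
have mb : measurable_fun setT beta by exact: measurable_funPT.
have mE S : measurable (beta @^-1` point S).
  by rewrite -[X in measurable X]setTI; apply: mb.
pose f S w := psi (addt (spike tau S) (z w)) * \1_(beta @^-1` point S) w.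
have mpS S : measurable_fun setT (fun x => psi (addt (spike tau S) x)).
  by apply: (measurableT_comp mpsi); exact: measurable_addt.
have mf S : measurable_fun setT (f S).
  apply: measurable_funM; first exact: (measurableT_comp (mpS S)).
  exact: measurable_indic.
have f0 S w : 0 <= f S w by rewrite mulr_ge0.
have -> : (\sum_(S : {set 'I_p}) (wt S)%:E *
    \int[P]_w (psi (addt (spike tau S) (z w)))%:E =
    \int[P]_w (\sum_S 1 * f S w)%:E)%E.
  rewrite ge0_integral_EFin_sum//; apply: eq_bigr => S _; rewrite mul1e.
  have mpE : measurable_fun setT (fun x => (psi (addt (spike tau S) x))%:E).
    exact/measurable_EFinP.
  have pz0 x : (0 <= (psi (addt (spike tau S) x))%:E)%E by rewrite lee_fin.
  have hind (C : set (p.-tuple R)) : measurable C ->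
      P (beta @^-1` point S `&` z @^-1` C) = ((wt S)%:E * distribution P z C)%E.
    by move=> mC; rewrite indep// prob_spike.
  have := integral_indep_event (nu := distribution P z) (mE S) mz (weight_ge0 e01 S) hind mpE pz0.
  rewrite ge0_integral_distribution// => <-.
have mbz := measurable_fun_addt mb mz.
apply: ge0_le_integral_EFin.
- by move=> w; apply: sumr_ge0 => S _; rewrite mul1r.
- apply: measurable_sum => S; exact: measurable_funM.
- exact: measurableT_comp.
move=> w.
have [[S /pointE bS]|none] := pselect (exists S, point S (beta w)).
  rewrite (bigD1 S)//= big1 => [|S' S'S].
    rewrite addr0 mul1r /f indicE mem_set/=; last exact/pointE.
    by rewrite mulr1 bS.
  rewrite mul1r /f indicE memNset ?mulr0//= => /pointE.
  by rewrite bS => /spike_inj SS'; move: S'S; rewrite SS' eqxx.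
rewrite big1// => S _; rewrite mul1r /f indicE memNset ?mulr0// => bS.
by apply: none; exists S.
Qed.

End signal_mixture.

Section risk.
Context (R : realType) (d : measure_display) (T : measurableType d)
  (P : probability T R) (p : nat) (beta z : {RV P >-> p.-tuple R})
  (theta r : R) (Sigma Omega : 'M[R]_p).
Hypothesis cov : is_covariance Sigma.
Hypothesis prec : is_precision Omega Sigma.
Hypothesis diag : forall i, Omega i i = 1.
Hypothesis noise : centered_gaussian z Sigma.
Hypothesis signal : iid beta (spike_law theta r p).
Hypothesis indep : independent beta z.
Local Notation e := (eps theta p).
Local Notation tau := (tau r p).
Local Notation D := (max_row_support Omega).
Hypothesis e01 : 0 <= e <= 1.
Hypothesis tau0 : tau != 0.
Local Notation wt := (support_weight e).

Let shift_z : gaussian_shift z Omega.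
Proof. exact: centered_gaussian_shift prec noise. Qed.

Let Omega_sym := precision_sym cov prec.

Let degree i : (#|[pred j | edge Omega i j]| <= D)%N.
Proof.
exact: (leq_bigmax (F := fun i : 'I_p => #|[pred j : 'I_p | Omega i j != 0%R]|)).
Qed.

Let mz : measurable_fun setT z.
Proof. exact: measurable_funPT. Qed.

Let measurable_observation : measurable_fun setT (fun w => addt (beta w) (z w)).
Proof. by apply: measurable_fun_addt; exact: measurable_funPT. Qed.

Lemma type1_errorE phi : type1_error P z phi = (\int[P]_w (phi (z w))%:E)%E.
Proof.
rewrite /type1_error unlock; apply: eq_integral => w _; congr (phi _)%:E.
by apply: eq_from_tnth => i; rewrite !tnth_mktuple add0r.
Qed.

Lemma type2_errorE phi :
  type2_error P beta z phi = (\int[P]_w (1 - phi (addt (beta w) (z w)))%:E)%E.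
Proof. by rewrite /type2_error unlock. Qed.

Let integral_complement (U : T -> p.-tuple R) (phi : p.-tuple R -> R) :
  measurable_fun setT U -> is_test phi ->
  exists2 a : R, 0 <= a <= 1 &
    (\int[P]_w (phi (U w))%:E)%E = a%:E /\
    (\int[P]_w (1 - phi (U w))%:E)%E = (1 - a)%:E.
Proof.
move=> mU [mphi phi01].
have mphiU : measurable_fun setT (fun w => phi (U w)) by exact: measurableT_comp.
have A1 : (\int[P]_w (phi (U w))%:E <= 1)%E.
  by apply: integral_prob_le1 => // w; exact: phi01.
have A0 : (0 <= \int[P]_w (phi (U w))%:E)%E.
  by apply: integral_ge0 => w _; rewrite lee_fin; have /andP[] := phi01 (U w).
have Afin : (\int[P]_w (phi (U w))%:E)%E \is a fin_num.
  by rewrite ge0_fin_numE// (le_lt_trans A1)// ltry.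
exists (fine (\int[P]_w (phi (U w))%:E)%E).
  by rewrite -!lee_fin fineK// A0.
split; first by rewrite fineK.
have := ge0_integral_EFinD P (f := fun w => phi (U w)) (g := fun w => 1 - phi (U w)).
under eq_integral do rewrite addrCA subrr addr0.
rewrite integral_prob_cst => sum1.
have {}sum1 : (1 = \int[P]_w (phi (U w))%:E + \int[P]_w (1 - phi (U w))%:E)%E.
  apply: sum1 => //.
  - by move=> w; have /andP[] := phi01 (U w).
  - by move=> w; rewrite subr_ge0; have /andP[] := phi01 (U w).
  - exact: measurable_funB.
by rewrite EFinB fineK// [in RHS]sum1 [X in _ = (X - _)%E]addeC addeK.
Qed.

(** Applying [null_vs_mixture] to a test and to its complement bounds the
    difference of its powers under the two hypotheses from both sides. *)
Lemma risk_near_one (phi : p.-tuple R -> R) (t s eta : R) :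
  is_test phi -> tau <= t -> 0 <= s -> 0 < eta ->
  exists2 x : R, (type1_error P z phi + type2_error P beta z phi)%E = x%:E &
    `|x - 1| <= eta + (second_moment_bound p D e tau t s - 1 +
                       mass_defect p D e tau t *+ 2) / (4 * eta).
Proof.
move=> phi_test tau_t s0 eta0; have [mphi phi01] := phi_test.
set gap := eta + _.
have [a _ [aE aE']] := integral_complement mz phi_test.
have [b _ [bE bE']] := integral_complement measurable_observation phi_test.
have main (psi : p.-tuple R -> R) : measurable_fun setT psi ->
    (forall x, 0 <= psi x <= 1) ->
    (\int[P]_w (psi (z w))%:E <= \int[P]_w (psi (addt (beta w) (z w)))%:E + gap%:E)%E.
  move=> mpsi psi01.
  apply: le_trans (null_vs_mixture shift_z Omega_sym diag (precision_le1 cov prec diag)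
    degree e01 tau_t s0 mpsi psi01 eta0) _.
  rewrite leeD2r//; apply: signal_mixture_le => // x.
  by have /andP[] := psi01 x.
have H1 := main _ mphi phi01.
have H2 : (\int[P]_w (1 - phi (z w))%:E <=
    \int[P]_w (1 - phi (addt (beta w) (z w)))%:E + gap%:E)%E.
  apply: (main (fun y => 1 - phi y)); first exact: measurable_funB.
  by move=> y; have /andP[? ?] := phi01 y; rewrite subr_ge0 lerBlDr lerDl; apply/andP.
exists (a + (1 - b)); first by rewrite type1_errorE type2_errorE aE bE'.
move: H1 H2; rewrite aE aE' bE bE' -!EFinD !lee_fin => H1 H2.
by rewrite ler_norml; apply/andP; split; move: H1 H2; move: (gap) => g; lra.
Qed.

Lemma count_test_is_test (t c : R) : is_test (count_test Omega t c).
Proof.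
by split; [exact: measurable_count_test|move=> y; exact: count_test01].
Qed.

(** Under the alternative the type II error is at most its average over the
    supports, by [signal_mixture_le] applied to the power of the test. *)
Lemma risk_small (t c : R) : 0 < c ->
  null_mean p t + 2 * c <= p%:R * ((1 - D%:R * e) * normal_tail t +
    (e - D%:R * e ^+ 2) * normal_tail (t - tau)) ->
  exists2 x : R,
    (type1_error P z (count_test Omega t c) +
     type2_error P beta z (count_test Omega t c))%E = x%:E &
    0 <= x <= D%:R ^+ 2 * null_mean p t / c ^+ 2 +
              D%:R ^+ 2 * (null_mean p t + 2 * c) / c ^+ 2.
Proof.
move=> c0 gap; have phi_test := count_test_is_test t c.
set phi := count_test Omega t c in phi_test *.
have [mphi phi01] := phi_test.
have [a /andP[a0 a1] [aE aE']] := integral_complement mz phi_test.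
have [b /andP[b0 b1] [bE bE']] := integral_complement measurable_observation phi_test.
exists (a + (1 - b)); first by rewrite type1_errorE type2_errorE aE bE'.
rewrite addr_ge0 ?subr_ge0//=; apply: lerD.
  rewrite -lee_fin -aE; exact: (count_test_type1 t shift_z Omega_sym diag degree c0).
rewrite -lee_fin -bE'.
have mix := count_test_type2 shift_z Omega_sym diag degree e01 c0
  (le_trans gap (mean_count_ge t diag degree e01 tau)).
apply: le_trans mix.
have my S : measurable_fun setT (fun w => addt (spike tau S) (z w)).
  by apply: measurableT_comp => //; exact: measurable_addt.
have cE S := integral_complement (my S) phi_test.
pose aS S : R := fine (\int[P]_w (phi (addt (spike tau S) (z w)))%:E)%E.
have aSE S : (\int[P]_w (phi (addt (spike tau S) (z w)))%:E)%E = (aS S)%:E.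
  by rewrite /aS; have [q _ [-> _]] := cE S.
have aSE' S : (\int[P]_w (1 - phi (addt (spike tau S) (z w)))%:E)%E = (1 - aS S)%:E.
  by rewrite /aS; have [q _ [-> ->]] := cE S.
have := signal_mixture_le signal indep e01 tau0 mphi (fun y => proj1 (andP (phi01 y))).
under eq_bigr do rewrite aSE -EFinM.
rewrite sumEFin bE bE' lee_fin => mixb.
under eq_bigr do rewrite aSE' -EFinM.
rewrite sumEFin lee_fin.
under eq_bigr do rewrite mulrBr mulr1.
by rewrite sumrB sum_weight lerD2l lerN2.
Qed.

End risk.

(** * The detection boundary *)

Section exponents.
Context (R : realType).
Implicit Types (theta r : R).

(** The exponent [m] of the truncated second moment [M = p ^ m], in terms of
    [rho = sqrt r] and of the tilt [s = sigma * sqrt (2 ln p)]. *)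
Definition moment_exponent (rho sigma : R) : R :=
  2 * (2 * (rho - sigma / 2) ^+ 2 - rho ^+ 2 + sigma).

(** The first inequality involving [theta] and [rho] makes the expected number of
    signals above [sqrt (2 ln p)] vanish, the last one controls the second moment.
    With [sigma] positive, that is for [rho > 1 / 2], both amount to
    [1 - theta < (1 - rho) ^+ 2]. *)
Lemma below_boundary theta r : 0 < theta < 1 -> 0 < r -> r < rho_star theta ->
  let rho := Num.sqrt r in let sigma := Num.max 0 (2 * rho - 1) in
  [/\ 2^-1 < theta, rho < 1, 1 - theta < (1 - rho) ^+ 2 &
      1 - 2 * theta + moment_exponent rho sigma < 0].
Proof.
move=> /andP[th0 th1] r0 + rho sigma; rewrite /rho_star.
have rr : rho ^+ 2 = r by rewrite sqr_sqrtr// ltW.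
have rho0 : 0 <= rho by exact: sqrtr_ge0.
rewrite -rr; case: ifPn => [_|]; first by rewrite ltNge sqr_ge0.
rewrite -ltNge => th_half; case: ifPn => [th34 rlt|].
  have rho_half : rho < 2^-1 by rewrite -(@ltr_pXn2r _ 2)// ?nnegrE ?invr_ge0//; lra.
  have sg : sigma = 0 by apply/max_idPl; lra.
  split=> //; first lra.
    have := sqr_ge0 (rho - 2^-1); nra.
  rewrite sg /moment_exponent; nra.
rewrite -ltNge => th34; set x := Num.sqrt (1 - theta).
have x0 : 0 <= x by exact: sqrtr_ge0.
have xx : x ^+ 2 = 1 - theta by rewrite sqr_sqrtr// subr_ge0 ltW.
have x_half : x < 2^-1 by rewrite -(@ltr_pXn2r _ 2)// ?nnegrE ?invr_ge0//; lra.
rewrite ltr_pXn2r ?nnegrE//; last lra.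
move=> rho_lt.
have gap : 1 - theta < (1 - rho) ^+ 2.
  by rewrite -xx ltr_pXn2r ?nnegrE//; lra.
split=> //; first lra.
rewrite /moment_exponent /sigma; have [rho_half|rho_half] := leP (2 * rho - 1) 0.
  nra.
nra.
Qed.

(** With threshold [kappa * sqrt (2 ln p)] the null count is of order
    [p ^ (1 - kappa ^+ 2)], up to logarithms, and the signals add
    [p ^ (1 - theta - alpha ^+ 2)]; the last inequality says that the signal exceeds
    the standard deviation. The exponent of the ratio is maximal at
    [kappa = 2 * rho], under the constraint [kappa <= 1]. *)
Lemma above_boundary theta r : 0 < theta < 1 -> 0 < r -> rho_star theta < r ->
  let rho := Num.sqrt r in let kappa := Num.min (2 * rho) 1 in
  let alpha := Num.max 0 (kappa - rho) in
  [/\ 0 < kappa, kappa <= 1, alpha ^+ 2 < kappa ^+ 2 &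
      0 < 2 * (1 - theta - alpha ^+ 2) - (1 - kappa ^+ 2)].
Proof.
move=> /andP[th0 th1] r0 + rho kappa alpha; rewrite /rho_star.
have rr : rho ^+ 2 = r by rewrite sqr_sqrtr// ltW.
have rho0 : 0 < rho by rewrite sqrtr_gt0.
rewrite -rr => above.
have k0 : 0 < kappa by rewrite lt_min mulr_gt0// ltr01.
have k1 : kappa <= 1 by rewrite ge_min lexx orbT.
have [rho_half|rho_half] := leP rho 2^-1.
  have kE : kappa = 2 * rho by apply/min_idPl; lra.
  have aE : alpha = rho.
    by rewrite /alpha kE; apply/eqP; rewrite (_ : 2 * rho - rho = rho) ?max_r ?ltW//; ring.
  split=> //; rewrite ?aE kE; first nra.
  move: above; case: ifPn => [th_half _|]; first nra.
  rewrite -ltNge => th_half; case: ifPn => [th34 rlt|]; first nra.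
  rewrite -ltNge => th34; set x := Num.sqrt (1 - theta).
  have x0 : 0 <= x by exact: sqrtr_ge0.
  have xx : x ^+ 2 = 1 - theta by rewrite sqr_sqrtr// subr_ge0 ltW.
  have x_half : x < 2^-1 by rewrite -(@ltr_pXn2r _ 2)// ?nnegrE ?invr_ge0//; lra.
  rewrite ltr_pXn2r ?nnegrE// ?ltW//; lra.
have kE : kappa = 1 by apply/min_idPr; lra.
have a_half : 0 <= alpha < 2^-1.
  by rewrite /alpha kE le_max lexx/= gt_max invr_gt0 ltr0n/=; lra.
have /andP[a0 ah] := a_half.
have a14 : alpha ^+ 2 < 4^-1.
  have -> : 4^-1 = 2^-1 ^+ 2 :> R by field.
  by rewrite ltr_pXn2r ?nnegrE// invr_ge0.
split=> //; rewrite kE; first by rewrite expr1n (lt_trans a14)//; lra.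
suff : alpha ^+ 2 < 1 - theta by rewrite expr1n; lra.
have [th34|th34] := leP theta (3 / 4); first lra.
move: above; rewrite ifF; last by apply/negbTE; rewrite -ltNge; lra.
rewrite ifF; last by apply/negbTE; rewrite -ltNge; lra.
set x := Num.sqrt (1 - theta).
have x0 : 0 < x by rewrite sqrtr_gt0 subr_gt0.
have xx : x ^+ 2 = 1 - theta by rewrite sqr_sqrtr// subr_ge0 ltW.
have x_half : x < 2^-1 by rewrite -(@ltr_pXn2r _ 2)// ?nnegrE ?invr_ge0// ?ltW//; lra.
rewrite ltr_pXn2r ?nnegrE// ?(ltW rho0)//; last lra.
move=> rho_gt; rewrite -xx ltr_pXn2r ?nnegrE// ?(ltW x0)// /alpha kE gt_max x0/=.
lra.
Qed.

End exponents.

(** * Large dimensions *)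

Section asymptotics.
Context (R : realType).
Implicit Types (a b x v : R) (p : nat).

Definition expo a p : R := expR (a * ln p%:R).

Lemma expoD a b p : expo (a + b) p = expo a p * expo b p.
Proof. by rewrite /expo mulrDl expRD. Qed.

Lemma expo_ge0 a p : 0 <= expo a p.
Proof. exact: expR_ge0. Qed.

Lemma expo_gt0 a p : 0 < expo a p.
Proof. exact: expR_gt0. Qed.

Lemma expoN a p : expo (- a) p = (expo a p)^-1.
Proof. by rewrite /expo mulNr expRN. Qed.

Lemma expo1 p : (0 < p)%N -> expo 1 p = p%:R.
Proof. by move=> p0; rewrite /expo mul1r lnK// posrE ltr0n. Qed.

Lemma powR_expo a p : (0 < p)%N -> p%:R `^ a = expo a p.
Proof. by move=> p0; rewrite /powR pnatr_eq0 gtn_eqF. Qed.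

Lemma near_ln_ge x : \forall p \near \oo, x <= ln p%:R.
Proof.
near=> p; rewrite -(expRK x) ler_ln ?posrE ?expR_gt0//.
  by near: p; exact: nbhs_infty_ger.
apply: lt_le_trans (expR_gt0 x) _.
by near: p; exact: nbhs_infty_ger.
Unshelve. all: by end_near. Qed.

Lemma near_gt1 : \forall p \near \oo, (1 < p)%N.
Proof. exact: nbhs_infty_gt. Qed.

Lemma near_expo_le a x : a < 0 -> 0 < x -> \forall p \near \oo, expo a p <= x.
Proof.
move=> a0 x0; near=> p.
rewrite /expo -[leRHS](lnK (x := x)) ?posrE// ler_expR -ler_ndivrMl//.
by near: p; exact: near_ln_ge.
Unshelve. all: by end_near. Qed.

Lemma expR_sub1_le v : 0 <= v <= 2^-1 -> expR v - 1 <= 2 * v.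
Proof.
move=> /andP[v0 v1]; have inv1 : expR v <= (1 - v)^-1.
  rewrite -[leLHS]invrK lef_pV2 ?posrE ?invr_gt0 ?expR_gt0//; last lra.
  by rewrite -expRN expR_ge1Dx.
have v2 : (1 - v)^-1 <= 1 + 2 * v.
  by rewrite -[leLHS]mul1r ler_pdivrMr; nra.
lra.
Qed.

Lemma cvge_near (u : nat -> \bar R) (l : R) :
  (forall eta, 0 < eta ->
    \forall p \near \oo, exists2 x, u p = x%:E & `|x - l| <= eta) ->
  u @ \oo --> l%:E.
Proof.
move=> H; apply/fine_cvgP; split.
  by near=> p; have [x -> _] : exists2 x, u p = x%:E & `|x - l| <= 1;
    [near: p; exact: H|].
apply/cvgrPdist_le => eta eta0; near=> p.
have [x /= -> /=] : exists2 x, u p = x%:E & `|x - l| <= eta.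
  by near: p; exact: H.
by rewrite distrC.
Unshelve. all: by end_near. Qed.

Lemma sparse_near (D : nat -> nat) a :
  (D p)%:R * p%:R `^ (- a) @[p --> \oo] --> 0 ->
  \forall p \near \oo, (D p)%:R <= expo a p.
Proof.
move=> /cvgrPdist_le/(_ 1 ltr01) H; near=> p.
have p0 : (0 < p)%N by apply: (@ltn_trans 1) => //; near: p; exact: near_gt1.
have : `|0 - (D p)%:R * p%:R `^ (- a)| <= 1 by near: p; exact: H.
rewrite sub0r normrN powR_expo// expoN ger0_norm.
  by rewrite ler_pdivrMr ?expo_gt0// mul1r.
by rewrite mulr_ge0// invr_ge0 expo_ge0.
Unshelve. all: by end_near. Qed.

Definition threshold (kappa : R) p : R := kappa * Num.sqrt (2 * ln p%:R).

Lemma threshold_sqr kappa p : (0 < p)%N ->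
  threshold kappa p ^+ 2 = 2 * kappa ^+ 2 * ln p%:R.
Proof.
move=> p0; have L0 : 0 <= ln (p%:R : R) by rewrite ln_ge0// ler1n.
by rewrite exprMn sqr_sqrtr ?mulr_ge0//; ring.
Qed.

Lemma tau_threshold (r : R) p : 0 <= r -> tau r p = threshold (Num.sqrt r) p.
Proof. by move=> r0; rewrite /tau /threshold -sqrtrM// mulrCA mulrA. Qed.

Lemma threshold_mono (kappa kappa' : R) p : kappa <= kappa' ->
  threshold kappa p <= threshold kappa' p.
Proof. by move=> k; rewrite ler_wpM2r// sqrtr_ge0. Qed.

Lemma eps_expo (theta : R) p : (0 < p)%N -> eps theta p = expo (- theta) p.
Proof. by move=> p0; rewrite /eps powR_expo. Qed.

Lemma eps01 (theta : R) p : 0 <= theta -> (0 < p)%N -> 0 <= eps theta p <= 1.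
Proof.
move=> th0 p0; rewrite eps_expo// expo_ge0/= -[leRHS]expR0 ler_expR.
by rewrite mulNr oppr_le0 mulr_ge0// ln_ge0// ler1n.
Qed.

Lemma tau_neq0 (r : R) p : 0 < r -> (1 < p)%N -> tau r p != 0.
Proof.
move=> r0 p1; rewrite /tau gt_eqF// sqrtr_gt0 !mulr_gt0//.
by rewrite ln_gt0// ltr1n.
Qed.

(** Below the boundary both moment errors of the truncated likelihood ratio
    vanish. *)
Lemma near_moment_errors (theta r : R) (D : nat -> nat) (eta : R) :
  0 < theta < 1 -> 0 < r -> r < rho_star theta ->
  (forall delta : R, 0 < delta ->
    (D p)%:R * p%:R `^ (- delta) @[p --> \oo] --> 0) ->
  0 < eta ->
  let sigma := Num.max 0 (2 * Num.sqrt r - 1) in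
  \forall p \near \oo,
    second_moment_bound p (D p) (eps theta p) (tau r p) (threshold 1 p)
      (threshold sigma p) - 1 +
    mass_defect p (D p) (eps theta p) (tau r p) (threshold 1 p) *+ 2 <= eta.
Proof.
move=> th01 r0 below sparse eta0 sigma.
have /andP[th0 th1] := th01.
pose rho := Num.sqrt r; pose m := moment_exponent rho sigma.
have [th_half rho1 gap1 gap2] : [/\ 2^-1 < theta, rho < 1,
    1 - theta < (1 - rho) ^+ 2 & 1 - 2 * theta + m < 0].
  exact: below_boundary.
pose g := - (1 - 2 * theta + m).
have g0 : 0 < g by rewrite oppr_gt0.
(* [expo delta p] bounds the row supports of the precision matrices; [delta] is
   small enough not to change the signs of the exponents below. *)
pose delta := Num.min g (2 * theta - 1) / 4.
have d0 : 0 < delta by rewrite divr_gt0// lt_min g0/=; lra.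
have dg : delta <= g / 4 by rewrite ler_pM2r ?invr_gt0// ge_min lexx.
have dth : delta <= (2 * theta - 1) / 4 by rewrite ler_pM2r ?invr_gt0// ge_min lexx orbT.
pose x : R := Num.min (eta / 16) (4^-1).
have x0 : 0 < x by rewrite lt_min divr_gt0//=; lra.
have xeta : x <= eta / 16 by rewrite ge_min lexx.
have x4 : x <= 4^-1 by rewrite ge_min lexx orbT.
have E1 : 1 + 2 * delta - 2 * theta < 0 by move: dth; lra.
have E2 : 1 - theta - (1 - rho) ^+ 2 < 0 by move: gap1; lra.
have E3 : - theta + m + delta < 0.
  by move: dg g0; rewrite /g; move: (m) => m'; lra.
have E4 : 1 - 2 * theta + m + delta < 0.
  by move: dg g0; rewrite /g; move: (m) => m'; lra.
near=> p.
have p1 : (1 < p)%N by near: p; exact: near_gt1.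
have p0 : (0 < p)%N by exact: ltn_trans p1.
have Dle : (D p)%:R <= expo delta p by near: p; apply: sparse_near; exact: sparse.
have H1 : expo (1 + 2 * delta - 2 * theta) p <= x by near: p; exact: near_expo_le.
have H2 : expo (1 - theta - (1 - rho) ^+ 2) p <= x by near: p; exact: near_expo_le.
have H3 : expo (- theta + m + delta) p <= 2^-1 by near: p; exact: near_expo_le.
have H4 : expo (1 - 2 * theta + m + delta) p <= x by near: p; exact: near_expo_le.
have L0 : 0 <= ln (p%:R : R) by rewrite ln_ge0// ler1n.
have e0 := expo_ge0 (- theta) p.
have tauE : tau r p = threshold rho p by rewrite tau_threshold// ltW.
have md : mass_defect p (D p) (eps theta p) (tau r p) (threshold 1 p) <= 2 * x.
  rewrite /mass_defect eps_expo// [leRHS]mulr_natl [leRHS]mulr2n; apply: lerD.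
    apply: le_trans H1.
    rewrite (_ : 1 + _ - _ = 1 + (delta + delta) + (- theta - theta)); last ring.
    rewrite !expoD expo1// !expr2 ler_wpM2r ?mulr_ge0// ler_wpM2l//.
    by rewrite ler_pM.
  apply: le_trans H2.
  rewrite !expoD expo1//; apply: ler_wpM2l; first by rewrite mulr_ge0.
  rewrite /expo ler_expR tauE -mulrBl -/(threshold (1 - rho) p).
  by rewrite threshold_sqr// le_eqVlt; apply/orP; left; apply/eqP; field.
have logM : expR (log_moment (tau r p) (threshold 1 p) (threshold sigma p)) = expo m p.
  congr expR; rewrite /log_moment tauE.
  rewrite (_ : threshold sigma p / 2 = threshold (sigma / 2) p); last first.
    by rewrite /threshold mulrAC.
  rewrite -mulrBl -/(threshold (rho - sigma / 2) p) !threshold_sqr//.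
  have -> : threshold sigma p * threshold 1 p = sigma * threshold 1 p ^+ 2.
    by rewrite /threshold; ring.
  by rewrite threshold_sqr// /m /moment_exponent; field.
pose y := eps theta p * expo m p * (D p)%:R.
have y_ge0 : 0 <= y by rewrite mulr_ge0// mulr_ge0 ?expo_ge0// eps_expo// expo_ge0.
have y1 : y <= 2^-1.
  apply: le_trans H3; rewrite !expoD /y eps_expo//.
  by rewrite ler_wpM2l// mulr_ge0// expo_ge0.
have yx : p%:R * (eps theta p * y) <= x.
  apply: le_trans H4.
  rewrite (_ : 1 - _ + _ + _ = 1 + (- theta) + (- theta) + m + delta); last ring.
  rewrite !expoD expo1// /y eps_expo// !mulrA ler_wpM2l//.
  by rewrite !mulr_ge0// expo_ge0.
have sm : second_moment_bound p (D p) (eps theta p) (tau r p) (threshold 1 p)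
      (threshold sigma p) - 1 <= 4 * x.
  rewrite /second_moment_bound logM -/y.
  have e0' : 0 <= eps theta p by rewrite eps_expo.
  have up : p%:R * (eps theta p * (expR y - 1)) <= 2 * x.
    apply: (@le_trans _ _ (2 * (p%:R * (eps theta p * y)))); last by rewrite ler_wpM2l.
    rewrite [leRHS]mulrCA ler_wpM2l// mulrCA ler_wpM2l//.
    by apply: expR_sub1_le; rewrite y_ge0.
  have ge0 : 0 <= p%:R * (eps theta p * (expR y - 1)).
    by rewrite !mulr_ge0// subr_ge0 -expR0 ler_expR.
  apply: le_trans (expR_sub1_le _) _; last by move: up; lra.
  by rewrite ge0/=; apply: le_trans up _; move: x4; lra.
rewrite mulr2n; move: sm md xeta.
by move: (second_moment_bound _ _ _ _ _ _) (mass_defect _ _ _ _ _) => u v; lra.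
Unshelve. all: by end_near. Qed.

(** Moving from [u] to [u + 1] multiplies the normal density by [expR (- u - 1 / 2)];
    for [u] of order [sqrt (ln p)] this is larger than any negative power of [p]. *)
Lemma near_normal_tail (alpha delta : R) : 0 <= alpha -> 0 < delta ->
  \forall p \near \oo, expo (- alpha ^+ 2 - delta) p <= normal_tail (threshold alpha p).
Proof.
move=> a0 d0; pose C := alpha ^+ 2 / delta + 2^-1 - ln (normal_peak (1 : R)).
have peak0 : 0 < normal_peak (1 : R) by rewrite normal_peak_gt0// oner_neq0.
near=> p.
have p1 : (1 < p)%N by near: p; exact: near_gt1.
have p0 : (0 < p)%N by exact: ltn_trans p1.
have big : 2 * C / delta <= ln p%:R by near: p; exact: near_ln_ge.
have L0 : 0 <= ln (p%:R : R) by rewrite ln_ge0// ler1n.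
have t0 : 0 <= threshold alpha p by rewrite mulr_ge0 ?sqrtr_ge0.
apply: le_trans (normal_tail_ge t0).
rewrite normal_pdfE ?oner_neq0// -[normal_peak 1](lnK (x := _)) ?posrE//.
rewrite /normal_fun -expRD ler_expR subr0.
set u := threshold alpha p.
have uu : u ^+ 2 = 2 * alpha ^+ 2 * ln p%:R by exact: threshold_sqr.
pose q : R := Num.sqrt (2 * ln (p%:R : R)).
have qq : q ^+ 2 = 2 * ln p%:R by rewrite sqr_sqrtr// mulr_ge0.
have uE : u = alpha * q by [].
have amgm : u <= alpha ^+ 2 / delta + delta * ln p%:R / 2.
  have -> : alpha ^+ 2 / delta + delta * ln p%:R / 2 =
      u + (alpha - delta * q / 2) ^+ 2 / delta.
    have -> : ln p%:R = q ^+ 2 / 2 by rewrite qq; field.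
    by rewrite uE; field; rewrite gt_eqF.
  by rewrite lerDl divr_ge0 ?sqr_ge0// ltW.
have big' : C <= delta * ln p%:R / 2.
  by move: big; rewrite ler_pdivrMr//; lra.
rewrite (_ : - (u + 1) ^+ 2 / (1 ^+ 2 *+ 2) = - (u ^+ 2 / 2) - u - 2^-1); last by field.
rewrite uu; move: big' amgm; rewrite /C; move: (ln (normal_peak 1)) => pk.
by move: (alpha ^+ 2) (alpha ^+ 2 / delta) => A B; lra.
Unshelve. all: by end_near. Qed.

(** Above the boundary the mean of the count moves by much more than its
    standard deviation. *)
Lemma near_count_separation (theta r : R) (D : nat -> nat) (eta : R) :
  0 < theta < 1 -> 0 < r -> rho_star theta < r ->
  (forall delta : R, 0 < delta ->
    (D p)%:R * p%:R `^ (- delta) @[p --> \oo] --> 0) ->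
  0 < eta ->
  let t p := threshold (Num.min (2 * Num.sqrt r) 1) p in
  let c p := p%:R * eps theta p * normal_tail (t p - tau r p) / 4 in
  \forall p \near \oo,
    [/\ 0 < c p,
        null_mean p (t p) + 2 * c p <=
          p%:R * ((1 - (D p)%:R * eps theta p) * normal_tail (t p) +
          (eps theta p - (D p)%:R * eps theta p ^+ 2) * normal_tail (t p - tau r p)) &
        (D p)%:R ^+ 2 * null_mean p (t p) / c p ^+ 2 +
        (D p)%:R ^+ 2 * (null_mean p (t p) + 2 * c p) / c p ^+ 2 <= eta].
Proof.
move=> th01 r0 above sparse eta0 t c.
have /andP[th0 th1] := th01.
pose rho := Num.sqrt r; pose kappa := Num.min (2 * rho) 1.
pose alpha := Num.max 0 (kappa - rho).
have [k0 k1 ak gap] : [/\ 0 < kappa, kappa <= 1, alpha ^+ 2 < kappa ^+ 2 &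
    0 < 2 * (1 - theta - alpha ^+ 2) - (1 - kappa ^+ 2)] by exact: above_boundary.
have kk1 : kappa ^+ 2 <= 1 by rewrite exprn_ile1// ltW.
have a0 : 0 <= alpha by rewrite le_max lexx.
have ka : kappa - rho <= alpha by rewrite le_max lexx orbT.
move: ak gap kk1; set A := alpha ^+ 2; set K := kappa ^+ 2 => ak gap kk1.
pose g := 2 * (1 - theta - A) - (1 - K).
have g0 : 0 < g by exact: gap.
(* [delta] absorbs both the row supports and the lower-order factor of the
   normal tail. *)
pose delta := Num.min (Num.min (g / 8) ((K - A) / 4)) (theta / 2).
have d0 : 0 < delta by rewrite !lt_min !divr_gt0// subr_gt0.
have dg : delta <= g / 8 by rewrite !ge_min lexx.
have dk : delta <= (K - A) / 4 by rewrite !ge_min lexx orbT.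
have dth : delta <= theta / 2 by rewrite ge_min lexx orbT.
pose x := Num.min (eta / 64) (4^-1 : R).
have x0 : 0 < x by rewrite lt_min divr_gt0//=; lra.
have xeta : x <= eta / 64 by rewrite ge_min lexx.
have x4 : x <= 4^-1 by rewrite ge_min lexx orbT.
have E1 : delta - theta < 0 by lra.
have E2 : delta - K + (A + delta) < 0 by lra.
have E3 : delta + delta + (1 - K) - (1 - theta - A - delta) * 2 < 0.
  by rewrite /g in dg g0; lra.
have E4 : delta + delta - (1 - theta - A - delta) < 0 by rewrite /g in dg g0; lra.
near=> p.
have p1 : (1 < p)%N by near: p; exact: near_gt1.
have p0 : (0 < p)%N by exact: ltn_trans p1.
have Dle : (D p)%:R <= expo delta p by near: p; apply: sparse_near; exact: sparse.
have H1 : expo (delta - theta) p <= x by near: p; exact: near_expo_le.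
have H2 : expo (delta - K + (A + delta)) p <= x by near: p; exact: near_expo_le.
have H3 : expo (delta + delta + (1 - K) - (1 - theta - A - delta) * 2) p <= x.
  by near: p; exact: near_expo_le.
have H4 : expo (delta + delta - (1 - theta - A - delta)) p <= x.
  by near: p; exact: near_expo_le.
have tail_ge : expo (- A - delta) p <= normal_tail (threshold alpha p).
  by near: p; exact: near_normal_tail.
have tauE : tau r p = threshold rho p by rewrite tau_threshold// ltW.
set pi1 := normal_tail (t p - tau r p); set pi0 := normal_tail (t p).
have pi1_ge : expo (- A - delta) p <= pi1.
  apply: le_trans tail_ge _; apply: normal_tail_anti.
  by rewrite tauE /t -mulrBl; exact: threshold_mono.
have pi1_gt0 : 0 < pi1 by exact: lt_le_trans (expo_gt0 _ _) pi1_ge.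
have pi0_ge0 : 0 <= pi0 by exact: normal_tail_ge0.
have pi0_le : pi0 <= expo (- K) p.
  have t0 : 0 <= t p by rewrite mulr_ge0 ?sqrtr_ge0// ltW.
  apply: le_trans (normal_tail_le t0) _; rewrite /expo ler_expR threshold_sqr//.
  by rewrite -/rho -/kappa -/K le_eqVlt; apply/orP; left; apply/eqP; field.
have eE : eps theta p = expo (- theta) p by rewrite eps_expo.
have e_gt0 : 0 < eps theta p by rewrite eE expo_gt0.
have pR0 : 0 < p%:R :> R by rewrite ltr0n.
have c_gt0 : 0 < c p by rewrite /c divr_gt0// !mulr_gt0.
have c_ge : expo (1 - theta - A - delta) p / 4 <= c p.
  rewrite /c ler_wpM2r ?invr_ge0//.
  rewrite (_ : 1 - theta - A - delta = 1 + - theta + (- A - delta)); last ring.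
  rewrite (expoD (1 + - theta)) (expoD 1) expo1// -eE; apply: ler_wpM2l => //.
  by rewrite ltW// mulr_gt0.
set Dp : R := (D p)%:R; have Dp0 : 0 <= Dp by rewrite ler0n.
have De : Dp * eps theta p <= x.
  by apply: le_trans H1; rewrite expoD eE ler_wpM2r// expo_ge0.
have Dpi : Dp * pi0 <= x * pi1.
  apply: (@le_trans _ _ (expo (delta - K) p)).
    by rewrite expoD ler_pM.
  apply: (@le_trans _ _ (x * expo (- A - delta) p)); last by rewrite ler_wpM2l// ltW.
  by rewrite -ler_pdivrMr ?expo_gt0// -expoN -expoD opprB opprK [delta + A]addrC.
split=> //.
  rewrite /null_mean -/pi0 /c -/pi1.
  have -> : p%:R * pi0 + 2 * (p%:R * eps theta p * pi1 / 4) =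
    p%:R * (pi0 + eps theta p * pi1 / 2) by field.
  apply: ler_wpM2l; first exact: ltW.
  have -> : (1 - Dp * eps theta p) * pi0 + (eps theta p - Dp * eps theta p ^+ 2) * pi1 =
    pi0 + eps theta p * pi1 - eps theta p * (Dp * pi0) -
    eps theta p * (Dp * eps theta p * pi1).
    by ring.
  have q1 : eps theta p * (Dp * pi0) <= eps theta p * pi1 * 4^-1.
    rewrite -[leRHS]mulrA ler_wpM2l ?(ltW e_gt0)// (le_trans Dpi)//.
    by rewrite mulrC ler_wpM2l ?(ltW pi1_gt0).
  have q2 : eps theta p * (Dp * eps theta p * pi1) <= eps theta p * pi1 * 4^-1.
    rewrite -[leRHS]mulrA ler_wpM2l ?(ltW e_gt0)// mulrC.
    by rewrite ler_wpM2l ?(ltW pi1_gt0)// (le_trans De).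
  by move: q1 q2; move: (eps theta p * _) => *; lra.
have Ec_gt0 := expo_gt0 (1 - theta - A - delta) p.
have cinv : (c p)^-1 <= 4 * expo (- (1 - theta - A - delta)) p.
  rewrite expoN -[4]invrK -invfM lef_pV2 ?posrE ?mulr_gt0 ?invr_gt0//.
  by rewrite mulrC.
have cinv0 : 0 <= (c p)^-1 by rewrite invr_ge0 ltW.
have D2 : Dp ^+ 2 <= expo (delta + delta) p by rewrite expoD expr2 ler_pM.
have D20 : 0 <= Dp ^+ 2 by exact: sqr_ge0.
have m_le : null_mean p (t p) <= expo (1 - K) p.
  by rewrite /null_mean expoD expo1// ler_wpM2l// ltW.
have m0 : 0 <= null_mean p (t p) by exact: null_mean_ge0.
have part1 : Dp ^+ 2 * null_mean p (t p) / c p ^+ 2 <= 16 * x.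
  apply: (@le_trans _ _ (expo (delta + delta) p * expo (1 - K) p *
    (4 * expo (- (1 - theta - A - delta)) p) ^+ 2)).
    rewrite -exprVn; apply: ler_pM; rewrite ?mulr_ge0 ?exprn_ge0//.
      by rewrite ler_pM.
    by rewrite !expr2; exact: (ler_pM cinv0 cinv0 cinv cinv).
  have -> : expo (delta + delta) p * expo (1 - K) p *
    (4 * expo (- (1 - theta - A - delta)) p) ^+ 2 =
    16 * expo (delta + delta + (1 - K) - (1 - theta - A - delta) * 2) p.
    rewrite [in RHS](_ : _ - _ * 2 = delta + delta + (1 - K) +
      (- (1 - theta - A - delta)) + (- (1 - theta - A - delta))); last ring.
    rewrite [in RHS]expoD [in RHS]expoD [in RHS]expoD; ring.
  by rewrite ler_wpM2l.
have part2 : Dp ^+ 2 / c p <= 4 * x.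
  apply: (@le_trans _ _ (expo (delta + delta) p * (4 * expo (- (1 - theta - A - delta)) p))).
    by rewrite ler_pM.
  by rewrite mulrCA -expoD ler_wpM2l.
have -> : Dp ^+ 2 * (null_mean p (t p) + 2 * c p) / c p ^+ 2 =
    Dp ^+ 2 * null_mean p (t p) / c p ^+ 2 + 2 * (Dp ^+ 2 / c p).
  by field; rewrite gt_eqF.
by lra.
Unshelve. all: by end_near. Qed.

End asymptotics.

Theorem theorem2p1 (R : realType) (theta r : R)
    (Sigma Omega : forall p : nat, 'M[R]_p)
    (d : nat -> measure_display) (T : forall p : nat, measurableType (d p))
    (P : forall p : nat, probability (T p) R)
    (beta z : forall p : nat, {RV (P p) >-> p.-tuple R})
    (htheta : 0 < theta < 1) (hr : 0 < r)
    (hARW : ARW theta r Sigma Omega P beta z) :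
  (r < rho_star theta ->
    forall phi : forall p : nat, p.-tuple R -> R,
      (forall p, is_test (phi p)) ->
      (type1_error (P p) (z p) (phi p) + type2_error (P p) (beta p) (z p) (phi p))%E
        @[p --> \oo] --> 1%E) /\
  (r > rho_star theta ->
    exists phi : forall p : nat, p.-tuple R -> R,
      (forall p, is_test (phi p) /\ nonrandomized (phi p)) /\
      (type1_error (P p) (z p) (phi p) + type2_error (P p) (beta p) (z p) (phi p))%E
        @[p --> \oo] --> 0%E).
Proof.
have /andP[th0 th1] := htheta.
have [cov prec diag sparse noise signal indep] := hARW.
split=> [below phi phi_test | above].
  apply: cvge_near => eta eta0.
  pose sigma := Num.max 0 (2 * Num.sqrt r - 1).
  have err := near_moment_errors htheta hr below sparse (exprn_gt0 2 eta0).
  have [_ rho1 _ _] := below_boundary htheta hr below.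
  near=> p.
  have p1 : (1 < p)%N by near: p; exact: near_gt1.
  have p0 : (0 < p)%N by exact: ltn_trans p1.
  have tau_t : tau r p <= threshold 1 p.
    by rewrite tau_threshold ?(ltW hr)//; apply: threshold_mono; exact: ltW.
  have s0 : 0 <= threshold sigma p.
    by rewrite mulr_ge0 ?sqrtr_ge0// le_max lexx.
  have eta2 : 0 < eta / 2 by rewrite divr_gt0.
  have [x xE xb] := risk_near_one (cov p) (prec p) (diag p) (noise p) (signal p)
    (indep p) (eps01 (ltW th0) p0) (tau_neq0 hr p1) (phi_test p) tau_t s0 eta2.
  exists x => //; apply: le_trans xb _.
  (* With [eta / 2] as free parameter, moment errors of at most [eta ^+ 2] add
     another [eta / 2]. *)
  rewrite [leRHS](splitr eta) lerD2l ler_pdivrMr; last by rewrite mulr_gt0.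
  rewrite (_ : eta / 2 * (4 * (eta / 2)) = eta ^+ 2); last by field.
  by near: p; exact: err.
pose t p := threshold (Num.min (2 * Num.sqrt r) 1) p.
pose c p := p%:R * eps theta p * normal_tail (t p - tau r p) / 4.
exists (fun p => count_test (Omega p) (t p) (c p)); split=> [p|].
  split; first exact: count_test_is_test.
  by move=> y; rewrite /count_test; case: (_ < _)%R; [right|left].
apply: cvge_near => eta eta0.
have sep := near_count_separation htheta hr above sparse eta0.
near=> p.
have p1 : (1 < p)%N by near: p; exact: near_gt1.
have p0 : (0 < p)%N by exact: ltn_trans p1.
have [c0 gap small] : [/\ 0 < c p,
    null_mean p (t p) + 2 * c p <=
      p%:R * ((1 - (max_row_support (Omega p))%:R * eps theta p) * normal_tail (t p) +
      (eps theta p - (max_row_support (Omega p))%:R * eps theta p ^+ 2) *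
        normal_tail (t p - tau r p)) &
    (max_row_support (Omega p))%:R ^+ 2 * null_mean p (t p) / c p ^+ 2 +
    (max_row_support (Omega p))%:R ^+ 2 * (null_mean p (t p) + 2 * c p) / c p ^+ 2
      <= eta].
  by near: p; exact: sep.
have [x xE /andP[x0 xb]] := risk_small (cov p) (prec p) (diag p) (noise p) (signal p)
  (indep p) (eps01 (ltW th0) p0) (tau_neq0 hr p1) c0 gap.
by exists x => //; rewrite subr0 ger0_norm// (le_trans xb).
Unshelve. all: by end_near. Qed.
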